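(* Given an instance $(D,v^* )$ of TFP, the problem can be solved in time $2^{\mathcal{O}(s\log s)}\cdot n^{\mathcal{O}(1)}$, where $n=|V(D)|$ and $s$ is the sum of the sfas-in number and the sfas-out number of $(D,v^* )$.
   Context: A tournament is a digraph with exactly one arc between every pair of distinct vertices; $(u,v)$ means $u$ beats $v$. TFP: given a tournament $D$ with $|V(D)|$ a power of two and a player $v^*$, decide whether there is a seeding of a balanced knockout tournament (complete binary tree with $|V(D)|$ leaves, in each round sibling winners play and the winner according to $D$ advances) under which $v^*$ is the champion. The sfas-in (resp. sfas-out) number of $(D,v^* )$ is the minimum number of arcs of $D$ whose reversal yields a digraph in which no directed cycle contains a vertex of $N_{\mathrm{in}}(v^* )$ (resp. $N_{\mathrm{out}}(v^* )$), where $N_{\mathrm{in}}(v^* )$, $N_{\mathrm{out}}(v^* )$ are the in- and out-neighborhoods of $v^*$. *)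

(* Defs.v *)
From mathcomp Require Import all_boot.
Set Implicit Arguments. Unset Strict Implicit. Unset Printing Implicit Defensive.

(* D x y  means  x beats y, i.e. (x,y) is an arc. *)
Definition is_tournament (T : finType) (D : rel T) : Prop :=
  (forall x, ~~ D x x) /\ (forall x y, x != y -> D x y = ~~ D y x).

(* one round of a balanced knockout: consecutive leaves/winners are siblings *)
Fixpoint ko_round (T : Type) (D : rel T) (s : seq T) : seq T :=
  match s with
  | a :: b :: t => (if D a b then a else b) :: ko_round D t
  | _ => s
  end.

(* there is a seeding (an ordering of all 2^k players on the leaves of the
   complete binary tree) under which v wins all k rounds *)
Definition TFP_yes (k : nat) (D : rel 'I_(2 ^ k)) (v : 'I_(2 ^ k)) : Prop :=
  exists s : seq 'I_(2 ^ k),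
    perm_eq s (enum 'I_(2 ^ k)) /\ iter k (ko_round D) s = [:: v].

Definition arcs (T : finType) (D : rel T) : {set T * T} := [set p | D p.1 p.2].

Definition reverse_arcs (T : finType) (D : rel T) (F : {set T * T}) : rel T :=
  fun x y => (D x y && ((x, y) \notin F)) || (D y x && ((y, x) \in F)).

Definition dcycle (T : finType) (E : rel T) (c : seq T) : Prop :=
  c != [::] /\ uniq c /\ cycle E c.

Definition kills_cycles_through (T : finType) (D : rel T) (X : pred T)
  (F : {set T * T}) : Prop :=
  F \subset arcs D /\
  forall c, dcycle (reverse_arcs D F) c -> forall u, u \in c -> ~~ X u.

Definition N_in (T : finType) (D : rel T) (v : T) : pred T := fun u => D u v.
Definition N_out (T : finType) (D : rel T) (v : T) : pred T := fun u => D v u.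

Definition min_reversal_number (T : finType) (D : rel T) (X : pred T) (k : nat)
  : Prop :=
  (exists F : {set T * T}, #|F| = k /\ kills_cycles_through D X F) /\
  (forall F : {set T * T}, kills_cycles_through D X F -> k <= #|F|).

Definition sfas_in_number (T : finType) (D : rel T) (v : T) (k : nat) : Prop :=
  min_reversal_number D (N_in D v) k.
Definition sfas_out_number (T : finType) (D : rel T) (v : T) (k : nat) : Prop :=
  min_reversal_number D (N_out D v) k.

Inductive move := MoveL | MoveR | Stay.

(* states 'I_q.+1 (start state = ord0); tape symbols 'I_m.+3 where
   0 = blank, 1 = bit false, 2 = bit true.  delta returns either a
   transition or a halting answer. *)
Record TM := mkTM {
  tm_q : nat;
  tm_m : nat;
  tm_delta : 'I_tm_q.+1 -> 'I_tm_m.+3 ->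
             ('I_tm_q.+1 * 'I_tm_m.+3 * move) + bool }.

Definition tape (M : TM) := (seq 'I_(tm_m M).+3 * 'I_(tm_m M).+3 * seq 'I_(tm_m M).+3)%type.
Definition config (M : TM) := ('I_(tm_q M).+1 * tape M)%type.

Definition blank (M : TM) : 'I_(tm_m M).+3 := ord0.
Definition bit_sym (M : TM) (b : bool) : 'I_(tm_m M).+3 := inord (if b then 2 else 1).

Definition do_move (M : TM) (mv : move) (t : tape M) : tape M :=
  let: (l, h, r) := t in
  match mv with
  | Stay => (l, h, r)
  | MoveL => match l with [::] => ([::], blank M, h :: r)
                         | x :: l' => (l', x, h :: r) end
  | MoveR => match r with [::] => (h :: l, blank M, [::])
                         | x :: r' => (h :: l, x, r') end
  end.

Definition tm_step (M : TM) (c : config M) : config M + bool :=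
  let: (st, (l, h, r)) := c in
  match tm_delta st h with
  | inl (st', w, mv) => inl (st', do_move mv (l, w, r))
  | inr b => inr b
  end.

Fixpoint tm_run (M : TM) (t : nat) (c : config M) : option bool :=
  match t with
  | 0 => None
  | t'.+1 => match tm_step c with
             | inl c' => tm_run t' c'
             | inr b => Some b
             end
  end.

Definition tm_init (M : TM) (w : seq bool) : config M :=
  (ord0, match [seq bit_sym M b | b <- w] with
         | [::] => ([::], blank M, [::])
         | x :: r => ([::], x, r)
         end).

Definition encode_instance (n : nat) (D : rel 'I_n) (v : 'I_n) : seq bool :=
  [seq u == v | u <- enum 'I_n] ++
  [seq D i j | i <- enum 'I_n, j <- enum 'I_n].

(* Main.v *)
Require Import Defs.
From mathcomp Require Import all_boot zify.
Set Implicit Arguments. Unset Strict Implicit. Unset Printing Implicit Defensive.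

(* Every directed triangle contains an in- or out-neighbour of v, so it contains one of
   the at most s arcs of the two optimal reversal sets.  Hence greedily collecting the
   triangles that meet the set A of vertices collected so far in at most one vertex ends
   with |A| <= 3s, and then no directed triangle has two vertices outside A.

   A knockout won by v assigns to every other player y the round tau y, counted from the
   final, in which y loses, and the player pi y who beats it.  For every y in A guess tau y
   and whether pi y is a given vertex of A or lies outside A.  An exchange argument shows
   that the rest can be filled in greedily, from the final downwards: a player of A whose
   opponent is outside A is given to the weakest available one, and every other survivor
   beats the strongest available player outside A.  With m = |A| and n = 2^k there are at
   most (k + m + 1)^(2m) <= (2m)^(2m) 2^(k+m+1) guesses, and this is 2^(O(s log s)) n.

   The running time is obtained through a machine with four stacks, which a Turing machine
   simulates with four tracks.  Binary trees, serialised in prefix order, are manipulated on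
   one of the stacks; the functions on encoded data that are computed in polynomial time
   this way are closed under pairing, case distinction and bounded folds. *)

(** * Stack machines and Turing machines *)

(** The exchange argument rests on one consequence of the triangle condition. If [x] beats [y] and
    both lie outside A, then [x] beats every player that [y] beats, and whoever beats [x] also beats
    [y], even when the third player lies in A. Strength among the players outside A is thus a linear
    order that the whole field respects, so a greedy choice can be swapped into any bracket.

    The optimal reversal sets occur only in the analysis. The machine knows neither them nor s and
    computes A from the arcs alone.

    Rounds are counted from the final because the search starts with v as the only survivor and
    doubles the field in each round. When a loser is placed, the bracket below it is still open, and
    this leaves room for exchanges.

    The number of guesses is not polynomial, so the search is not itself a polynomial-time function
    in the sense developed here. Only one turn of it is, and the loop around that turn is built
    directly from machines. *)

Notation quad A := (A * A * A * A)%type.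
Notation idx := (bool * bool)%type.

Definition qget A (q : quad A) (i : idx) : A :=
  let: (a, b, c, d) := q in
  match i with
  | (false, false) => a | (false, true) => b | (true, false) => c | (true, true) => d
  end.

Definition qset A (q : quad A) (i : idx) (x : A) : quad A :=
  let: (a, b, c, d) := q in
  match i with
  | (false, false) => (x, b, c, d) | (false, true) => (a, x, c, d)
  | (true, false) => (a, b, x, d) | (true, true) => (a, b, c, x)
  end.

Lemma qget_set A (q : quad A) i j x :
  qget (qset q i x) j = if i == j then x else qget q j.
Proof. by case: q => [[[? ?] ?] ?]; case: i => [[] []]; case: j => [[] []]. Qed.

Definition stacks := quad (seq bool).

Inductive instr (N : Type) :=
  | IPush of idx & bool & N
  | IPop of idx & (option bool -> N).

Record machine := Machine {
  mQ : finType;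
  mstart : mQ + option bool;
  mcode : mQ -> instr (mQ + option bool) }.

Definition mstate (M : machine) := ((mQ M + option bool) * stacks)%type.

Definition mstep (M : machine) (c : mstate M) : mstate M :=
  match c.1 with
  | inr _ => c
  | inl q => match mcode q with
    | IPush i b nx => (nx, qset c.2 i (b :: qget c.2 i))
    | IPop i nx => (nx (ohead (qget c.2 i)), qset c.2 i (behead (qget c.2 i)))
    end
  end.

Definition runs (M : machine) (s : stacks) (x : option bool) (s' : stacks) (t : nat) :=
  exists2 t', t' <= t & iter t' (@mstep M) (mstart M, s) = (inr x, s').

Section Simulation.

Variable M : machine.
Let P := (mQ M + option bool)%type.

(* Control states: two initialisation states; then, for the head resting on the
   home cell, walking right to the first free cell of a track, stepping back from
   it, and returning to the home cell. *)
Definition ctl : finType := (bool + (P + (mQ M + (mQ M + P))))%type.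
Definition c_init (b : bool) : ctl := inl b.
Definition c_exec (p : P) : ctl := inr (inl p).
Definition c_walk (q : mQ M) : ctl := inr (inr (inl q)).
Definition c_back (q : mQ M) : ctl := inr (inr (inr (inl q))).
Definition c_ret (p : P) : ctl := inr (inr (inr (inr p))).

(* [None] marks the home cell; [Some c] holds one cell of each of the four tracks. *)
Definition sym : finType := option (quad (option bool)).
Definition nocell : quad (option bool) := (None, None, None, None).
Definition track (i : idx) (y : sym) : option bool :=
  if y is Some c then qget c i else None.

(** The machine model fixes the first three tape symbols as blank and the two bits. Reading them as
    an empty cell and as a bit on the first track makes the raw input a valid tape. Decoding is
    therefore not injective, and only [enc_symK] is used. *)
Definition specials : seq sym :=
  [:: Some nocell; Some (Some false, None, None, None);
      Some (Some true, None, None, None)].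

Definition dec_sym (y : 'I_#|sym|.+3) : sym := nth (Some nocell) (specials ++ enum sym) y.
Definition enc_sym (y : sym) : 'I_#|sym|.+3 := inord (3 + index y (enum sym)).
Definition dec_ctl (q : 'I_#|ctl|.+1) : ctl := nth (c_init false) (c_init false :: enum ctl) q.
Definition enc_ctl (q : ctl) : 'I_#|ctl|.+1 := inord (1 + index q (enum ctl)).

Arguments dec_sym : simpl never.
Arguments enc_sym : simpl never.
Arguments dec_ctl : simpl never.
Arguments enc_ctl : simpl never.

Lemma enc_symK y : dec_sym (enc_sym y) = y.
Proof.
have lt_i : index y (enum sym) < #|sym| by rewrite cardE index_mem mem_enum.
rewrite /dec_sym /enc_sym inordK; last by rewrite !ltnS.
by rewrite nth_cat /= addKn nth_index // mem_enum.
Qed.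

Lemma enc_ctlK q : dec_ctl (enc_ctl q) = q.
Proof.
have lt_i : index q (enum ctl) < #|ctl| by rewrite cardE index_mem mem_enum.
by rewrite /dec_ctl /enc_ctl inordK ?ltnS //= nth_index // mem_enum.
Qed.

(** The first move goes left off the input and creates a fresh cell, which is then marked as home. A
    pop from an empty stack steps back onto the home cell, which shows that the track was empty. A
    push never reaches [c_back], so the answer there is arbitrary. *)
Definition ctl_step (q : ctl) (y : sym) : (ctl * option sym * move) + bool :=
  match q with
  | inl false => inl (c_init true, None, MoveL)
  | inl true => inl (c_exec (mstart M), Some None, Stay)
  | inr (inl (inl q)) => inl (c_walk q, None, MoveR)
  | inr (inl (inr x)) => inr (x == Some true)
  | inr (inr (inl q)) =>
      match mcode q with
      | IPush i b nx =>
          if track i y is None then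
            inl (c_ret nx, Some (Some (qset (odflt nocell y) i (Some b))), MoveL)
          else inl (c_walk q, None, MoveR)
      | IPop i nx =>
          if track i y is None then inl (c_back q, None, MoveL)
          else inl (c_walk q, None, MoveR)
      end
  | inr (inr (inr (inl q))) =>
      match mcode q with
      | IPush i b nx => inr false
      | IPop i nx =>
          if y is Some c then
            inl (c_ret (nx (qget c i)), Some (Some (qset c i None)), MoveL)
          else inl (c_exec (nx None), None, Stay)
      end
  | inr (inr (inr (inr p))) =>
      if y is None then inl (c_exec p, None, Stay) else inl (c_ret p, None, MoveL)
  end.

Definition TM_of : TM :=
  @mkTM #|ctl| #|sym| (fun q y =>
    match ctl_step (dec_ctl q) (dec_sym y) with
    | inl (q', w, mv) => inl (enc_ctl q', if w is Some z then enc_sym z else y, mv)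
    | inr b => inr b
    end).

Notation conf := (config TM_of).
Notation tsym := ('I_#|sym|.+3).

Fixpoint steps (t : nat) (c c' : conf) : Prop :=
  match t with
  | 0 => c = c'
  | t'.+1 => exists2 c1, tm_step c = inl c1 & steps t' c1 c'
  end.

Lemma steps_cat t1 t2 c c1 c2 : steps t1 c c1 -> steps t2 c1 c2 -> steps (t1 + t2) c c2.
Proof.
elim: t1 c => [|t1 IH] c /=; first by move=> ->.
by case=> c0 e0 h1 h2; exists c0 => //; apply: IH.
Qed.

Lemma steps_run t t' c c' : steps t c c' -> tm_run (t + t') c = tm_run t' c'.
Proof.
elim: t c => [|t IH] c /=; first by move=> ->.
by case=> c0 e0 h1; rewrite e0; apply: IH.
Qed.

Definition zip_tape (l r : seq tsym) : tape TM_of :=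
  match r with [::] => (l, ord0, [::]) | x :: r' => (l, x, r') end.

Lemma zip_tapeE l r : zip_tape l r = (l, head ord0 r, behead r).
Proof. by case: r. Qed.

Lemma walk_right q i u l v :
  (forall y, y \in u -> track i (dec_sym y)) ->
  (match mcode q with IPush j _ _ => j | IPop j _ => j end) = i ->
  steps (size u) (enc_ctl (c_walk q), zip_tape l (u ++ v))
                 (enc_ctl (c_walk q), zip_tape (catrev u l) v).
Proof.
move=> + ei; elim: u l => [|y u IH] l uP //=.
have := uP y (mem_head _ _); case ey: (track i (dec_sym y)) => [b|] // _.
exists (enc_ctl (c_walk q), zip_tape (y :: l) (u ++ v)); last first.
  by apply: IH => z zu; apply: uP; rewrite inE zu orbT.
rewrite enc_ctlK /= ; case em: (mcode q) ei => [j c nx|j nx] /= ->; rewrite ey /=;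
  by rewrite zip_tapeE; case: (u ++ v).
Qed.

Lemma catrev_rcons (T : Type) (u : seq T) x l : catrev (rcons u x) l = x :: catrev u l.
Proof. by elim: u l => //= y u IH l. Qed.

Lemma return_home p u w r h :
  (forall z, z \in u -> dec_sym z != None) -> dec_sym h = None ->
  steps (size u).+1 (enc_ctl (c_ret p), @do_move TM_of MoveL (catrev u [:: h], w, r))
                    (enc_ctl (c_exec p), ([::], h, u ++ w :: r)).
Proof.
move=> + eh; elim/last_ind: u w r => [|u z IH] w r uP /=.
  by exists (enc_ctl (c_exec p), ([::], h, w :: r)) => //; rewrite enc_ctlK /= eh.
rewrite catrev_rcons size_rcons /=.
have : dec_sym z != None by apply: uP; rewrite mem_rcons mem_head.
case ez: (dec_sym z) => [c|//] _.
exists (enc_ctl (c_ret p), @do_move TM_of MoveL (catrev u [:: h], z, w :: r)).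
  by rewrite enc_ctlK /= ?ez.
rewrite cat_rcons; apply: IH => x xu; apply: uP; by rewrite mem_rcons inE xu orbT.
Qed.

(* The right part [r] of the tape stores stack [i] bottom first on track [i]. *)
Definition stores (r : seq tsym) (s : stacks) :=
  (forall y, y \in r -> dec_sym y != None) /\
  forall i, exists k, [seq track i (dec_sym y) | y <- r] =
                      map Some (rev (qget s i)) ++ nseq k None.

Definition at_home (p : P) (s : stacks) (c : conf) :=
  exists h r, [/\ dec_sym h = None, stores r s & c = (enc_ctl (c_exec p), ([::], h, r))].

Lemma stores_split r s i : stores r s -> exists u v,
  [/\ r = u ++ v, size u = size (qget s i),
      [seq track i (dec_sym y) | y <- u] = map Some (rev (qget s i)) &
      exists k, [seq track i (dec_sym y) | y <- v] = nseq k None].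
Proof.
move=> [_ /(_ i) [k ek]]; pose m := size (qget s i).
exists (take m r), (drop m r).
have sm : size (map Some (rev (qget s i))) = m by rewrite size_map size_rev.
have mr : m <= size r by rewrite -(size_map (fun y => track i (dec_sym y))) ek size_cat sm leq_addr.
split; rewrite ?cat_take_drop // ?size_takel //.
  by rewrite map_take ek -sm take_size_cat.
by exists k; rewrite map_drop ek -sm drop_size_cat.
Qed.

Lemma nseq_behead_ex (T : Type) (x : T) l k : l = nseq k x -> exists k', behead l = nseq k' x.
Proof. by move=> ->; exists k.-1; case: k. Qed.


(** Rewriting a cell and appending one are treated together: when [v] is empty, [head ord0 v] is the
    blank beyond the right end, which decodes to an empty cell. *)
Lemma stores_set (r : seq tsym) (u v : seq tsym) s i y x :
  r = u ++ v -> stores r s ->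
  (forall j, j != i -> track j (dec_sym y) = track j (dec_sym (head ord0 v))) ->
  dec_sym y != None ->
  (exists k, [seq track i (dec_sym y) | y <- u ++ y :: behead v] =
     map Some (rev x) ++ nseq k None) ->
  stores (u ++ y :: behead v) (qset s i x).
Proof.
move=> -> [nr tr] ty ny ti; split=> [z|j].
  rewrite mem_cat inE => /or3P[zu|/eqP ->//|zv]; apply: nr; rewrite mem_cat ?zu //.
  by rewrite (mem_behead zv) orbT.
rewrite qget_set; case: (eqVneq i j) => [<- //|nij].
have [k ek] := tr j.
case: v ty ti ek {nr tr} => [|z v] /= ty _ ek; last first.
  by exists k; rewrite -ek !map_cat /= ty // eq_sym.
exists k.+1; rewrite map_cat /= ty; last by rewrite eq_sym.
move: ek; rewrite cats0 => ->; rewrite -catA; congr (_ ++ _).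
by elim: (k) => [|k' /= ->] //; case: (j) => [[] []].
Qed.

Lemma at_home_push q i b nx s c :
  mcode q = IPush i b nx -> at_home (inl q) s c ->
  exists t c', [/\ t <= (size (qget s i)).*2 + 5, steps t c c' &
                 at_home nx (qset s i (b :: qget s i)) c'].
Proof.
move=> em [h [r [eh st ->]]].
have [u [v [er su eu [kv ev]]]] := stores_split i st.
pose y := Some (qset (odflt nocell (dec_sym (head ord0 v))) i (Some b)) : sym.
have hv : track i (dec_sym (head ord0 v)) = None.
  by case: (v) ev => [|z v'] //=; [case: (i) => [[] []] | case: (kv) => [|?] []].
have nu z : z \in u -> dec_sym z != None by move=> zu; apply: st.1; rewrite er mem_cat zu.
exists (1 + (size u + (1 + (size u).+1)))%N.
exists (enc_ctl (c_exec nx), ([::], h, u ++ enc_sym y :: behead v)); split.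
- by rewrite su -addnn; lia.
- apply: (@steps_cat _ _ _ (enc_ctl (c_walk q), zip_tape [:: h] (u ++ v))).
    by exists (enc_ctl (c_walk q), zip_tape [:: h] (u ++ v)) => //=;
      rewrite enc_ctlK /= er zip_tapeE; case: (u ++ v).
  apply: steps_cat.
    apply: (@walk_right _ i) => [z zu|]; last by rewrite em.
    have : track i (dec_sym z) \in map Some (rev (qget s i)).
      by rewrite -eu; apply: (map_f (fun y => track i (dec_sym y))).
    by case/mapP=> x _ ->.
  apply: (@steps_cat _ _ _ (enc_ctl (c_ret nx),
     @do_move TM_of MoveL (catrev u [:: h], enc_sym y, behead v))).
    exists (enc_ctl (c_ret nx), @do_move TM_of MoveL (catrev u [:: h], enc_sym y, behead v)) => //.
    by rewrite zip_tapeE /= enc_ctlK /= em hv.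
  exact: return_home.
exists h, (u ++ enc_sym y :: behead v); split=> //.
apply: (stores_set er) => //; rewrite ?enc_symK //=.
  move=> j nij; rewrite qget_set eq_sym (negbTE nij).
  by case: (dec_sym _) => //=; case: (j) => [[] []].
have [k' ek'] := nseq_behead_ex ev.
exists k'; rewrite map_cat eu /= enc_symK /= qget_set eqxx -behead_map ek'.
by rewrite rev_cons map_rcons cat_rcons.
Qed.

Lemma at_home_pop q i nx s c :
  mcode q = IPop i nx -> at_home (inl q) s c ->
  exists t c', [/\ t <= (size (qget s i)).*2 + 5, steps t c c' &
                 at_home (nx (ohead (qget s i))) (qset s i (behead (qget s i))) c'].
Proof.
move=> em [h [r [eh st ->]]].
have [u [v [er su eu [kv ev]]]] := stores_split i st.
have hv : track i (dec_sym (head ord0 v)) = None.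
  by case: (v) ev => [|z v'] //=; [case: (i) => [[] []] | case: (kv) => [|?] []].
have walk : steps (1 + (size u + 1)) (enc_ctl (c_exec (inl q)), ([::], h, r))
    (enc_ctl (c_back q), @do_move TM_of MoveL (catrev u [:: h], head ord0 v, behead v)).
  apply: (@steps_cat _ _ _ (enc_ctl (c_walk q), zip_tape [:: h] (u ++ v))).
    by exists (enc_ctl (c_walk q), zip_tape [:: h] (u ++ v)) => //=;
      rewrite enc_ctlK /= er zip_tapeE; case: (u ++ v).
  apply: steps_cat.
    apply: (@walk_right _ i) => [z zu|]; last by rewrite em.
    have : track i (dec_sym z) \in map Some (rev (qget s i)).
      by rewrite -eu; apply: (map_f (fun y => track i (dec_sym y))).
    by case/mapP=> x _ ->.
  exists (enc_ctl (c_back q), @do_move TM_of MoveL (catrev u [:: h], head ord0 v, behead v)) => //.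
  by rewrite zip_tapeE /= enc_ctlK /= em hv.
have [k' ek'] := nseq_behead_ex ev.
have nhv : dec_sym (head ord0 v) != None.
  by case: (v) er => [|z v'] // er; apply: st.1; rewrite er mem_cat mem_head orbT.
case es: (qget s i) su eu => [|b s'] su eu.
  case: u su eu er walk => // _ _ er walk.
  exists (1 + (0 + 1) + 1)%N.
  exists (enc_ctl (c_exec (nx None)), ([::], h, head ord0 v :: behead v)); split=> //.
    apply: steps_cat walk _.
    by exists (enc_ctl (c_exec (nx None)), ([::], h, head ord0 v :: behead v)) => //=;
      rewrite enc_ctlK /= em eh.
  exists h, (head ord0 v :: behead v); split=> //.
  apply: (@stores_set r [::] v) => //.
  by exists k'.+1; rewrite /= hv -behead_map ek'.
case/lastP: u su eu er walk => [|u z] // su eu er walk.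
have := eu; rewrite rev_cons !map_rcons => /rcons_inj[eu' ez].
move: su; rewrite size_rcons => -[su].
have [cz ecz] : exists c, dec_sym z = Some c by case: (dec_sym z) ez => // c2 _; exists c2.
pose y := Some (qset cz i None) : sym.
have nu x : x \in u -> dec_sym x != None.
  by move=> xu; apply: st.1; rewrite er mem_cat mem_rcons inE xu orbT.
exists ((1 + (size (rcons u z) + 1)) + (1 + (size u).+1))%N.
exists (enc_ctl (c_exec (nx (Some b))), ([::], h, u ++ enc_sym y :: head ord0 v :: behead v)); split.
- by rewrite size_rcons /= su -addnn; lia.
- apply: steps_cat walk _; rewrite catrev_rcons.
  apply: (@steps_cat _ _ _ (enc_ctl (c_ret (nx (Some b))),
     @do_move TM_of MoveL (catrev u [:: h], enc_sym y, head ord0 v :: behead v))).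
    exists (enc_ctl (c_ret (nx (Some b))),
     @do_move TM_of MoveL (catrev u [:: h], enc_sym y, head ord0 v :: behead v)) => //.
    by move: ez; rewrite /= enc_ctlK /= em ecz /= => ->.
  exact: return_home.
exists h, (u ++ enc_sym y :: head ord0 v :: behead v); split=> //.
(* The walk to the first free cell may have lengthened the tape by one blank, so the invariant is
   first restored for the longer tape and then the cell of [z] is cleared. *)
have st' : stores (u ++ z :: head ord0 v :: behead v) s.
  have := @stores_set r (rcons u z) v s i (head ord0 v) (qget s i) er st.
  rewrite cat_rcons; have -> : qset s i (qget s i) = s.
    by case: (s) => [[[? ?] ?] ?]; case: (i) => [[] []].
  apply=> //; exists k'.+1.
  by rewrite es rev_cons map_rcons map_cat /= eu' ez hv -behead_map ek' cat_rcons.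
apply: (@stores_set _ u (z :: head ord0 v :: behead v) s i _ _ erefl st') => //=; rewrite ?enc_symK //.
  by move=> j nij; rewrite ecz /= qget_set eq_sym (negbTE nij).
exists k'.+2; rewrite map_cat eu' /= enc_symK /= qget_set eqxx hv -behead_map ek' //.
Qed.

Definition height (s : stacks) :=
  let: (a, b, c, d) := s in size a + size b + size c + size d.

Lemma size_qget_height s i : size (qget s i) <= height s.
Proof. by case: s => [[[a b] c] d]; case: i => [[] []] /=; lia. Qed.

Lemma height_qset s i x : size x <= (size (qget s i)).+1 -> height (qset s i x) <= (height s).+1.
Proof. by case: s => [[[a b] c] d]; case: i => [[] []] /=; lia. Qed.

(** Each instruction raises the total height by at most one, so no stack exceeds [height s + t]
    during the run, and a single instruction costs one walk along a stack and back. *)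
Lemma simulate t p s p' s' c :
  iter t (@mstep M) (p, s) = (p', s') -> at_home p s c ->
  exists t' c', [/\ t' <= t * ((height s + t).*2 + 5), steps t' c c' & at_home p' s' c'].
Proof.
elim: t p s c => [|t IH] p s c; first by move=> [<- <-] hc; exists 0, c.
rewrite iterSr => e hc.
case: p e hc => [q|x] e hc; last first.
  have [t' [c' [le st' hc']]] := IH _ _ _ e hc.
  exists t', c'; split=> //; apply: leq_trans le _; rewrite mulSn -!addnn; nia.
move: e; rewrite /mstep /=; case em: (mcode q) => [i b nx|i nx] /= e.
- have [t1 [c1 [le1 st1 h1]]] := at_home_push em hc.
  have [t' [c' [le st' hc']]] := IH _ _ _ e h1.
  exists (t1 + t'), c'; split=> //; last exact: steps_cat st1 st'.
  have := @height_qset s i (b :: qget s i) (leqnn _); have := size_qget_height s i.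
  move: le le1; rewrite -!addnn; nia.
- have [t1 [c1 [le1 st1 h1]]] := at_home_pop em hc.
  have [t' [c' [le st' hc']]] := IH _ _ _ e h1.
  exists (t1 + t'), c'; split=> //; last exact: steps_cat st1 st'.
  have := @height_qset s i (behead (qget s i)).
  rewrite size_behead => /(_ (leq_trans (leq_pred _) (leqnSn _))).
  have := size_qget_height s i.
  move: le le1; rewrite -!addnn; nia.
Qed.

End Simulation.

Lemma dec_sym_bit M b : dec_sym (@bit_sym (TM_of M) b) = Some (Some b, None, None, None).
Proof. by rewrite /dec_sym /bit_sym inordK; case: b. Qed.

(** The bottom of a stack lies next to the home cell, so the input is a stack with its last bit on
    top, hence [rev w]. The summand 3 counts two initial steps and the halting step. *)
Theorem TM_of_correct (M : machine) (w : seq bool) (x : option bool) (s' : stacks) (t : nat) :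
  runs M (rev w, [::], [::], [::]) x s' t ->
  exists2 t', t' <= t * ((size w + t).*2 + 5) + 3 &
    @tm_run (TM_of M) t' (tm_init (TM_of M) w) = Some (x == Some true).
Proof.
move=> [t0 le0 e].
set r0 := [seq bit_sym (TM_of M) b | b <- w].
(* For the empty word the scanned blank stays on the tape as one empty cell. *)
pose r := head ord0 r0 :: behead r0.
pose c0 : config (TM_of M) := (enc_ctl (c_exec (mstart M)), ([::], enc_sym None, r)).
have st0 : steps 2 (tm_init (TM_of M) w) c0.
  rewrite /tm_init -/r0 /=.
  exists (enc_ctl (c_init M true), ([::], ord0, r)); first by rewrite /r; case: (r0).
  by exists c0 => //=; rewrite enc_ctlK.
have hc : at_home (mstart M) (rev w, [::], [::], [::]) c0.
  exists (enc_sym None), r; split=> //; first exact: enc_symK.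
  split=> [y|i].
    rewrite /r /r0; case: (w) => [|b w'] /=; first by rewrite inE => /eqP ->.
    rewrite -[_ :: _]/(map _ (b :: w')) => /mapP[b' _ ->].
    by rewrite (@dec_sym_bit M).
  have -> : qget (rev w, [::], [::], [::]) i = if i == (false, false) then rev w else [::].
    by case: i => [[] []].
  rewrite /r /r0; case: (w) => [|b w'] /=.
    by exists 1; case: i => [[] []].
  have E v : [seq track i (@dec_sym y) | y <- [seq bit_sym (TM_of M) b | b <- v]] =
      [seq (if i == (false, false) then Some b else None) | b <- v].
    by elim: v => //= b' v ->; rewrite (@dec_sym_bit M); case: (i) => [[] []].
  move: (E (b :: w')) => /= -> {E}; case: ifP => _; first by exists 0; rewrite revK cats0.
  by exists (size w').+1; rewrite /=; congr (_ :: _); elim: w' => //= ? ? ->.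
have [t' [c' [le st' [h [r' [_ _ ec]]]]]] := simulate e hc.
exists ((2 + t') + 1).
  move: le le0; rewrite /= size_rev !addn0 -!addnn => le le0; nia.
by rewrite (steps_run _ (steps_cat st0 st')) /= ec /= enc_ctlK.
Qed.

(** * Composition of stack machines *)

Definition map_instr (N N' : Type) (h : N -> N') (i : instr N) : instr N' :=
  match i with
  | IPush i b nx => IPush i b (h nx)
  | IPop i nx => IPop i (fun o => h (nx o))
  end.

(** A halted [M] idles, while its image under [h] may run on. The idle steps are dropped, which is
    why the new time is only bounded by the old one. *)
Lemma run_embed (M M' : machine) (h : mQ M + option bool -> mQ M' + option bool) :
  (forall q, exists2 q', h (inl q) = inl q' & mcode q' = map_instr h (mcode q)) ->
  forall t p s x s', iter t (@mstep M) (p, s) = (inr x, s') ->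
  exists2 t', t' <= t & iter t' (@mstep M') (h p, s) = (h (inr x), s').
Proof.
move=> hP; elim=> [|t IH] p s x s'; first by move=> [-> ->]; exists 0.
rewrite iterSr; case: p => [q|y] e; last first.
  by have [t' le e'] := IH _ _ _ _ e; exists t' => //; apply: leqW.
have [q' eq' ec] := hP q.
move: e; rewrite /mstep /=; case em: (mcode q) => [i b nx|i nx] /= e;
  have [t' le e'] := IH _ _ _ _ e; exists t'.+1; rewrite ?ltnS // iterSr -e';
  by congr (iter _ _ _); rewrite eq' /mstep /= ec em.
Qed.

Definition mret (x : option bool) : machine :=
  @Machine void (inr x) (fun q => match q with end).
Definition mpush (i : idx) (b : bool) : machine :=
  @Machine unit (inl tt) (fun _ => IPush i b (inr (Some true))).
Definition mpop (i : idx) : machine :=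
  @Machine unit (inl tt) (fun _ => IPop i (fun o => inr o)).

Section Bind.
Variables (M : machine) (f : option bool -> machine).
Let Q : finType := (mQ M + {x : option bool & mQ (f x)})%type.
Definition bind2 x (p : mQ (f x) + option bool) : Q + option bool :=
  match p with
  | inl q => inl (inr (Tagged (fun x => mQ (f x)) q))
  | inr y => inr y
  end.
Definition bind1 (p : mQ M + option bool) : Q + option bool :=
  match p with inl q => inl (inl q) | inr x => bind2 (mstart (f x)) end.
Definition mbind : machine :=
  @Machine Q (bind1 (mstart M)) (fun q =>
    match q with
    | inl q => map_instr bind1 (mcode q)
    | inr (existT x q) => map_instr (@bind2 x) (mcode q)
    end).
End Bind.

Definition loop1 (M : machine) (p : mQ M + option bool) : mQ M + option bool :=
  match p with
  | inl q => inl q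
  | inr (Some true) => mstart M
  | inr x => inr x
  end.
Definition mloop (M : machine) : machine :=
  @Machine (mQ M) (mstart M) (fun q => map_instr (@loop1 M) (mcode q)).

Definition mseq (M M' : machine) := mbind M (fun _ => M').

Lemma runs_weaken M s x s' t t' : runs M s x s' t -> t <= t' -> runs M s x s' t'.
Proof. by case=> t0 le e le'; exists t0 => //; apply: leq_trans le le'. Qed.

Lemma runs_ret x s t : runs (mret x) s x s t. Proof. by exists 0. Qed.

Lemma runs_push i b s : runs (mpush i b) s (Some true) (qset s i (b :: qget s i)) 1.
Proof. by exists 1. Qed.

Lemma runs_pop i s : runs (mpop i) s (ohead (qget s i)) (qset s i (behead (qget s i))) 1.
Proof. by exists 1. Qed.

Lemma runs_bind M f s x s1 y s2 t1 t2 :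
  runs M s x s1 t1 -> runs (f x) s1 y s2 t2 -> runs (mbind M f) s y s2 (t1 + t2).
Proof.
move=> [t1' le1 e1] [t2' le2 e2].
have [|u1 l1 r1] := @run_embed M (mbind M f) (@bind1 M f) _ _ _ _ _ _ e1.
  by move=> q; exists (inl q).
have [|u2 l2 r2] := @run_embed (f x) (mbind M f) (@bind2 M f x) _ _ _ _ _ _ e2.
  by move=> q; exists (inr (Tagged (fun x => mQ (f x)) q)).
exists (u2 + u1); first by lia.
by rewrite iterD r1 r2.
Qed.

Lemma runs_seq M M' s x s1 y s2 t1 t2 :
  runs M s x s1 t1 -> runs M' s1 y s2 t2 -> runs (mseq M M') s y s2 (t1 + t2).
Proof. exact: runs_bind. Qed.

Lemma loop1_start M : loop1 (mstart M) = mstart M.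
Proof. by case e: (mstart M) => [q|[[]|]] //=; rewrite e. Qed.

Lemma runs_loop_next M s s1 y s2 t1 t2 :
  runs M s (Some true) s1 t1 -> runs (mloop M) s1 y s2 t2 ->
  runs (mloop M) s y s2 (t1 + t2).
Proof.
move=> [t1' le1 e1] [t2' le2 e2].
have [|u1 l1 r1] := @run_embed M (mloop M) (@loop1 M) _ _ _ _ _ _ e1.
  by move=> q; exists q.
exists (t2' + u1); first by lia.
by rewrite iterD /= -loop1_start r1.
Qed.

Lemma runs_loop_exit M s x s1 t1 : x != Some true ->
  runs M s x s1 t1 -> runs (mloop M) s x s1 t1.
Proof.
move=> nx [t1' le1 e1].
have [|u1 l1 r1] := @run_embed M (mloop M) (@loop1 M) _ _ _ _ _ _ e1.
  by move=> q; exists q.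
exists u1; first by lia.
rewrite /= -loop1_start r1; congr (_, _).
by case: x nx {e1 r1} => [[]|].
Qed.

Lemma height_step M (c : mstate M) : height (mstep c).2 <= (height c.2).+1.
Proof.
case: c => [[q|x] s] //=; rewrite /mstep /=.
by case: (mcode q) => [i b nx|i nx] /=; apply: height_qset; rewrite ?size_behead //=; lia.
Qed.

Lemma runs_height M s x s' t : runs M s x s' t -> height s' <= height s + t.
Proof.
move=> [t' le e]; apply: leq_trans (leq_add (leqnn _) le).
have -> : s' = (iter t' (@mstep M) (mstart M, s)).2 by rewrite e.
elim: t' {e le} => [|t' IH]; first by rewrite addn0.
by rewrite iterS addnS; apply: leq_trans (height_step _) _.
Qed.

(** * Trees on a stack *)

Inductive tree := Leaf | Node of tree & tree.

Fixpoint ser (t : tree) : seq bool :=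
  match t with
  | Leaf => [:: false]
  | Node a b => true :: ser a ++ ser b
  end.

Definition tsz (t : tree) := size (ser t).

Lemma tsz_node a b : tsz (Node a b) = (tsz a + tsz b).+1.
Proof. by rewrite /tsz /= size_cat. Qed.
Lemma tsz_gt0 t : 0 < tsz t. Proof. by case: t. Qed.

Notation iT := (false, false).
Notation iM := (false, true).
Notation iC := (true, false).
Notation iU := (true, true).

(* Moves the topmost serialised tree of the main stack, reversed, to stack [i];
   stack [iC] counts the subtrees that remain to be read. *)
Definition mmove_body i :=
  mbind (mpop iC) (fun o => if o is Some _ then
    mbind (mpop iM) (fun o => if o is Some b then
      mseq (mpush i b)
        (if b then mseq (mpush iC true) (mpush iC true) else mret (Some true))
      else mret None)
    else mret None).
Definition mmove i := mseq (mpush iC true) (mloop (mmove_body i)).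

(** The rest of the run is a hypothesis, so that in the induction on [t] the second subtree and what
    follows serve as the continuation of the first. A node exchanges one pending subtree for two;
    each serialised bit takes at most five instructions. *)
Lemma runs_move_loop i t z c s x s' k :
  i \in [:: iT; iU] ->
  qget s iM = ser t ++ z -> qget s iC = true :: c ->
  runs (mloop (mmove_body i))
    (qset (qset (qset s i (catrev (ser t) (qget s i))) iM z) iC c) x s' k ->
  runs (mloop (mmove_body i)) s x s' (5 * tsz t + k).
Proof.
move=> iP; elim: t z c s x s' k => [|a IHa b IHb] z c s x s' k.
  case: s => [[[s1 s2] s3] s4] /= -> -> h.
  have -> : 5 * tsz Leaf + k = (1 + (1 + (1 + 0))) + (2 + k) by [].
  apply: runs_loop_next.
    apply: runs_bind (runs_pop _ _) _ => /=; apply: runs_bind (runs_pop _ _) _ => /=.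
    by apply: runs_seq (runs_push _ _ _) (runs_ret _ _ 0).
  by apply: runs_weaken (leq_addl _ _); move: h; case: (i) iP => [[] []].
case: s => [[[s1 s2] s3] s4] /= -> -> h.
rewrite tsz_node; have -> : 5 * (tsz a + tsz b).+1 + k =
  (1 + (1 + (1 + (1 + 1)))) + (5 * tsz a + (5 * tsz b + k)) by lia.
apply: runs_loop_next.
  apply: runs_bind (runs_pop _ _) _ => /=; apply: runs_bind (runs_pop _ _) _ => /=.
  apply: runs_seq (runs_push _ _ _) _.
  exact: runs_seq (runs_push _ _ _) (runs_push _ _ _).
apply: (IHa (ser b ++ z) (true :: c)); rewrite ?catA.
- by case: (i) iP => [[] []].
- by case: (i) iP => [[] []].
apply: (IHb z c).
- by case: (i) iP => [[] []].
- by case: (i) iP => [[] []].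
have ecat (u : seq bool) : catrev (ser b) (catrev (ser a) u) = catrev (ser a ++ ser b) u.
  by rewrite catrev_catl.
by move: h; case: (i) iP => [[] []] //= _; rewrite ecat.
Qed.

Lemma runs_move i t z s :
  i \in [:: iT; iU] -> qget s iM = ser t ++ z -> qget s iC = [::] ->
  runs (mmove i) s None (qset (qset s i (catrev (ser t) (qget s i))) iM z) (5 * tsz t + 2).
Proof.
move=> iP eM eC; have -> : 5 * tsz t + 2 = 1 + (5 * tsz t + 1) by lia.
apply: runs_seq (runs_push _ _ _) _.
apply: (@runs_move_loop i t z [::]) => //.
- by case: s eM {eC} => [[[? ?] ?] ?].
- by case: s eC {eM} => [[[? ?] ?] ?] /= ->.
have -> : qset (qset s i (catrev (ser t) (qget s i))) iM z =
  qset (qset (qset (qset s iC (true :: qget s iC)) i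
     (catrev (ser t) (qget (qset s iC (true :: qget s iC)) i))) iM z) iC [::].
  by case: s eC {eM} => [[[? ?] ?] ?] /=; case: (i) iP => [[] []] //= _ ->.
set s1 := qset _ iC [::].
apply: runs_loop_exit => //.
have e1 : qget s1 iC = [::] by rewrite qget_set.
have -> : 1 = 1 + 0 by [].
apply: runs_bind (runs_pop _ _) _; rewrite e1 /=.
have -> : qset s1 iC [::] = s1 by rewrite /s1; case: (s) => [[[? ?] ?] ?]; case: (i) iP => [[] []].
exact: runs_ret.
Qed.

(** Pouring reverses, which undoes the reversal made by [mmove]. An empty [js] discards the stack,
    and two targets copy it. *)
Definition mpour i js := mloop (mbind (mpop i) (fun o => if o is Some b then
    foldr (fun j m => mseq (mpush j b) m) (mret (Some true)) js else mret None)).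

Lemma runs_pushes js b s :
  runs (foldr (fun j m => mseq (mpush j b) m) (mret (Some true)) js) s (Some true)
    (foldl (fun s j => qset s j (b :: qget s j)) s js) (size js).
Proof.
elim: js s => [|j js IH] s /=; first exact: runs_ret.
by rewrite -add1n; apply: runs_seq (runs_push _ _ _) (IH _).
Qed.

Lemma runs_pour_M s1 s2 s3 s4 :
  runs (mpour iT [:: iM]) (s1, s2, s3, s4) None ([::], catrev s1 s2, s3, s4) (2 * size s1 + 1).
Proof.
elim: s1 s2 => [|b s1 IH] s2.
  apply: runs_loop_exit => //; rewrite -[X in runs _ _ _ _ X]/(1 + 0).
  by apply: runs_bind (runs_pop _ _) _; apply: runs_ret.
have -> : 2 * size (b :: s1) + 1 = (1 + 1) + (2 * size s1 + 1) by rewrite /=; lia.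
by apply: runs_loop_next (IH _); apply: runs_bind (runs_pop _ _) _; apply: (@runs_pushes [:: iM]).
Qed.

Lemma runs_pour_UM s1 s2 s3 s4 :
  runs (mpour iU [:: iM]) (s1, s2, s3, s4) None (s1, catrev s4 s2, s3, [::]) (2 * size s4 + 1).
Proof.
elim: s4 s2 => [|b s4 IH] s2.
  apply: runs_loop_exit => //; rewrite -[X in runs _ _ _ _ X]/(1 + 0).
  by apply: runs_bind (runs_pop _ _) _; apply: runs_ret.
have -> : 2 * size (b :: s4) + 1 = (1 + 1) + (2 * size s4 + 1) by rewrite /=; lia.
by apply: runs_loop_next (IH _); apply: runs_bind (runs_pop _ _) _; apply: (@runs_pushes [:: iM]).
Qed.

Lemma runs_pour_UT s1 s2 s3 s4 :
  runs (mpour iU [:: iT]) (s1, s2, s3, s4) None (catrev s4 s1, s2, s3, [::]) (2 * size s4 + 1).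
Proof.
elim: s4 s1 => [|b s4 IH] s1.
  apply: runs_loop_exit => //; rewrite -[X in runs _ _ _ _ X]/(1 + 0).
  by apply: runs_bind (runs_pop _ _) _; apply: runs_ret.
have -> : 2 * size (b :: s4) + 1 = (1 + 1) + (2 * size s4 + 1) by rewrite /=; lia.
by apply: runs_loop_next (IH _); apply: runs_bind (runs_pop _ _) _; apply: (@runs_pushes [:: iT]).
Qed.

Lemma runs_pour_TMU s1 s2 s3 s4 :
  runs (mpour iT [:: iM; iU]) (s1, s2, s3, s4) None
    ([::], catrev s1 s2, s3, catrev s1 s4) (3 * size s1 + 1).
Proof.
elim: s1 s2 s4 => [|b s1 IH] s2 s4.
  apply: runs_loop_exit => //; rewrite -[X in runs _ _ _ _ X]/(1 + 0).
  by apply: runs_bind (runs_pop _ _) _; apply: runs_ret.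
have -> : 3 * size (b :: s1) + 1 = (1 + 2) + (3 * size s1 + 1) by rewrite /=; lia.
by apply: runs_loop_next (IH _ _); apply: runs_bind (runs_pop _ _) _; apply: (@runs_pushes [:: iM; iU]).
Qed.

Lemma runs_clear s1 s2 s3 s4 :
  runs (mpour iT [::]) (s1, s2, s3, s4) None ([::], s2, s3, s4) (size s1 + 1).
Proof.
elim: s1 => [|b s1 IH].
  apply: runs_loop_exit => //; rewrite -[X in runs _ _ _ _ X]/(1 + 0).
  by apply: runs_bind (runs_pop _ _) _; apply: runs_ret.
have -> : size (b :: s1) + 1 = (1 + 0) + (size s1 + 1) by rewrite /=; lia.
by apply: runs_loop_next IH; apply: runs_bind (runs_pop _ _) _; apply: (@runs_pushes [::]).
Qed.

Definition flat (xs : seq tree) : seq bool := flatten (map ser xs).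

Lemma flat_cons x xs : flat (x :: xs) = ser x ++ flat xs. Proof. by []. Qed.
Lemma flat_cat xs ys : flat (xs ++ ys) = flat xs ++ flat ys.
Proof. by rewrite /flat map_cat flatten_cat. Qed.

Definition onmain (m : seq bool) : stacks := ([::], m, [::], [::]).

(* Concatenative semantics: [M] replaces the trees [xs] on top of the main stack by [ys]. *)
Definition trans (M : machine) (xs ys : seq tree) (t : nat) :=
  forall z, exists x, runs M (onmain (flat xs ++ z)) x (onmain (flat ys ++ z)) t.

Lemma trans_weaken M xs ys t t' : trans M xs ys t -> t <= t' -> trans M xs ys t'.
Proof. by move=> h le z; have [x hx] := h z; exists x; apply: runs_weaken hx le. Qed.

Lemma trans_seq M M' xs ys zs t t' :
  trans M xs ys t -> trans M' ys zs t' -> trans (mseq M M') xs zs (t + t').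
Proof.
move=> h h' z; have [x hx] := h z; have [y hy] := h' z.
by exists y; apply: runs_seq hx hy.
Qed.

Lemma trans_frame M xs ys ws t : trans M xs ys t -> trans M (xs ++ ws) (ys ++ ws) t.
Proof. by move=> h z; have [x hx] := h (flat ws ++ z); exists x; rewrite !flat_cat -!catA. Qed.

Lemma trans_ret x xs : trans (mret x) xs xs 0.
Proof. by move=> z; exists x; apply: runs_ret. Qed.

Lemma trans_cons a b : trans (mpush iM true) [:: a; b] [:: Node a b] 1.
Proof. by move=> z; exists (Some true); rewrite !flat_cons /= -!catA; apply: runs_push. Qed.

Lemma trans_uncons a b : trans (mpop iM) [:: Node a b] [:: a; b] 1.
Proof.
move=> z; exists (Some true); rewrite !flat_cons /= -!catA.
exact: (@runs_pop iM (onmain (true :: ser a ++ ser b ++ flat [::] ++ z))).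
Qed.

Lemma catrevK (u v : seq bool) : catrev (catrev u [::]) v = u ++ v.
Proof. by rewrite -[catrev u [::]]/(rev u) catrevE revK. Qed.
Lemma size_catrev0 (u : seq bool) : size (catrev u [::]) = size u.
Proof. exact: size_rev. Qed.

Definition mdrop := mseq (mmove iT) (mpour iT [::]).
(** The second copy reaches [iU] with its first bit on top, so a direct pour would reverse it; it
    therefore returns by way of [iT]. *)
Definition mdup := mseq (mmove iT) (mseq (mpour iT [:: iM; iU])
   (mseq (mpour iU [:: iT]) (mpour iT [:: iM]))).
Definition mswap := mseq (mmove iT) (mseq (mmove iU) (mseq (mpour iT [:: iM]) (mpour iU [:: iM]))).

Lemma trans_drop a : trans mdrop [:: a] [::] (10 * tsz a).
Proof.
move=> z; exists None; rewrite flat_cons cats0.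
apply: (@runs_weaken _ _ _ _ ((5 * tsz a + 2) + (tsz a + 1))); last by have := tsz_gt0 a; lia.
apply: runs_seq (@runs_move iT a z _ _ _ _) _ => //=.
by rewrite -[X in X + 1](size_catrev0 (ser a)); apply: runs_clear.
Qed.

Lemma trans_dup a : trans mdup [:: a] [:: a; a] (20 * tsz a).
Proof.
move=> z; exists None; rewrite !flat_cons cats0.
apply: (@runs_weaken _ _ _ _ ((5 * tsz a + 2) + ((3 * tsz a + 1) + ((2 * tsz a + 1) + (2 * tsz a + 1)))));
  last by have := tsz_gt0 a; lia.
apply: runs_seq (@runs_move iT a z _ _ _ _) _ => //=.
apply: runs_seq; first by rewrite -[X in 3 * X + 1](size_catrev0 (ser a)); apply: runs_pour_TMU.
rewrite !catrevK cats0.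
apply: runs_seq; first exact: runs_pour_UT.
have := runs_pour_M (catrev (ser a) [::]) (ser a ++ z) [::] [::].
by rewrite catrevK size_catrev0 /onmain -catA.
Qed.

Lemma trans_swap a b : trans mswap [:: a; b] [:: b; a] (20 * (tsz a + tsz b)).
Proof.
move=> z; exists None; rewrite !flat_cons cats0 -!catA.
apply: (@runs_weaken _ _ _ _ ((5 * tsz a + 2) + ((5 * tsz b + 2) + ((2 * tsz a + 1) + (2 * tsz b + 1)))));
  last by have := tsz_gt0 a; have := tsz_gt0 b; lia.
apply: runs_seq (@runs_move iT a (ser b ++ z) _ _ _ _) _ => //=.
apply: runs_seq (@runs_move iU b z _ _ _ _) _ => //=.
apply: runs_seq; first by rewrite -[X in 2 * X + 1](size_catrev0 (ser a)); apply: runs_pour_M.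
have := runs_pour_UM [::] (ser a ++ z) [::] (catrev (ser b) [::]).
by rewrite !catrevK size_catrev0.
Qed.

Definition mconst (t : tree) :=
  foldr (fun b m => mseq m (mpush iM b)) (mret (Some true)) (ser t).

Lemma trans_const t : trans (mconst t) [::] [:: t] (tsz t).
Proof.
move=> z; exists (Some true); rewrite flat_cons cats0 /mconst /tsz.
elim: (ser t) => [|b w IH] /=; first exact: runs_ret.
by rewrite -addn1; apply: runs_seq IH (runs_push _ _ _).
Qed.

(* Loops as long as the first component of the tree on top is not a leaf. *)
Definition mwhile (M : machine) := mloop (mbind (mpop iM) (fun _ =>
  mbind (mpop iM) (fun o => if o is Some true then
      mseq (mpush iM true) (mseq (mpush iM true) (mseq M (mret (Some true))))
    else mseq (mpush iM false) (mseq (mpush iM true) (mret None))))).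

Lemma trans_while M (x : nat -> tree) n K :
  (forall i, i < n -> exists a b c, x i = Node (Node a b) c) ->
  (exists c, x n = Node Leaf c) ->
  (forall i, i < n -> trans M [:: x i] [:: x i.+1] K) ->
  trans (mwhile M) [:: x 0] [:: x n] (n * (K + 4) + 4).
Proof.
elim: n x => [|n IH] x xN xL xM z.
  have [c e] := xL; exists None; rewrite !flat_cons /= e /=.
  apply: runs_loop_exit => //.
  rewrite -[0 * _ + _]/(1 + (1 + (1 + (1 + 0)))).
  apply: runs_bind (runs_pop _ _) _ => /=; apply: runs_bind (runs_pop _ _) _ => /=.
  apply: runs_seq (runs_push _ _ _) _; apply: runs_seq (runs_push _ _ _) _.
  exact: runs_ret.
have [y hy] : exists y, runs (mwhile M) (onmain (flat [:: x 1] ++ z)) y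
    (onmain (flat [:: x n.+1] ++ z)) (n * (K + 4) + 4).
  by apply: (IH (fun i => x i.+1)) => // i lt; [apply: xN | apply: xM].
exists y; rewrite mulSn -addnA; apply: runs_loop_next hy.
have [a [b [c e]]] := xN 0 isT; have [y' h] := xM 0 isT z.
move: h; rewrite e !flat_cons /= => h.
have -> : K + 4 = 1 + (1 + (1 + (1 + (K + 0)))) by lia.
apply: runs_bind (runs_pop _ _) _ => /=; apply: runs_bind (runs_pop _ _) _ => /=.
apply: runs_seq (runs_push _ _ _) _; apply: runs_seq (runs_push _ _ _) _.
exact: runs_seq h (runs_ret _ _ _).
Qed.

(** * Functions computed in polynomial time *)

Class encodable (T : Type) := enc : T -> tree.

#[export] Instance enc_unit : encodable unit := fun _ => Leaf.
#[export] Instance enc_bool : encodable bool := fun b => if b then Node Leaf Leaf else Leaf.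
(** Unary, so that a number has the same tree as a list of units and recursion on numbers becomes a
    list fold. *)
#[export] Instance enc_nat : encodable nat := fix enc_nat (n : nat) : tree :=
  if n is n'.+1 then Node Leaf (enc_nat n') else Leaf.
#[export] Instance enc_prod A B `{encodable A} `{encodable B} : encodable (A * B) :=
  fun p => Node (enc p.1) (enc p.2).
#[export] Instance enc_seq A `{encodable A} : encodable (seq A) :=
  fix enc_seq (l : seq A) : tree := if l is a :: l' then Node (enc a) (enc_seq l') else Leaf.

Definition esz {A} `{encodable A} (a : A) := tsz (enc a).

Lemma esz_gt0 A `{encodable A} (a : A) : 0 < esz a. Proof. exact: tsz_gt0. Qed.
Lemma esz_pair A B `{encodable A} `{encodable B} (a : A) (b : B) :
  esz (a, b) = (esz a + esz b).+1.
Proof. exact: tsz_node. Qed.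
Lemma esz_cons A `{encodable A} (a : A) l : esz (a :: l) = (esz a + esz l).+1.
Proof. exact: tsz_node. Qed.
Lemma esz_nat (n : nat) : esz n = n.*2.+1.
Proof.
elim: n => // n IH; rewrite -[esz n.+1]/(tsz (Node Leaf (enc n))) tsz_node.
by rewrite -[tsz (enc n)]/(esz n) IH doubleS.
Qed.
Lemma esz_bool (b : bool) : esz b <= 3. Proof. by case: b. Qed.
Lemma size_esz A `{encodable A} (l : seq A) : size l <= esz l.
Proof. by elim: l => //= a l IH; rewrite esz_cons; lia. Qed.

(* [PB g]: polynomially bounded; [PT f]: computed in polynomial time. *)
Definition PB A `{encodable A} (g : A -> nat) := exists c, forall a, g a <= c * esz a ^ c.

Section PolyBound.
Context {A : Type} `{encodable A}.
Implicit Types f g : A -> nat.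

Lemma PB_le f g : (forall a, f a <= g a) -> PB g -> PB f.
Proof. by move=> le [c gP]; exists c => a; apply: leq_trans (le a) (gP a). Qed.

Lemma PB_const k : PB (fun _ : A => k).
Proof. by exists k => a; rewrite leq_pmulr // expn_gt0 esz_gt0. Qed.

Lemma PB_esz : PB (fun a : A => esz a). Proof. by exists 1 => a; rewrite mul1n expn1. Qed.

Lemma PB_add f g : PB f -> PB g -> PB (fun a => f a + g a).
Proof.
move=> [c fP] [d gP]; exists (c + d) => a; rewrite mulnDl.
have n0 := esz_gt0 a; apply: leq_add.
  by apply: leq_trans (fP a) _; apply: leq_mul => //; apply: leq_pexp2l => //; lia.
by apply: leq_trans (gP a) _; apply: leq_mul => //; apply: leq_pexp2l => //; lia.
Qed.

Lemma PB_mul f g : PB f -> PB g -> PB (fun a => f a * g a).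
Proof.
move=> [c fP] [d gP]; exists (c * d + (c + d)) => a; have n0 := esz_gt0 a.
apply: leq_trans (leq_mul (fP a) (gP a)) _.
rewrite mulnACA -expnD; apply: leq_mul; first by lia.
by apply: leq_pexp2l => //; lia.
Qed.

Lemma PB_exp f c : PB f -> PB (fun a => f a ^ c).
Proof.
move=> fP; elim: c => [|c IH]; first exact: PB_const 1.
by apply: PB_le (PB_mul fP IH) => a; rewrite expnS.
Qed.
End PolyBound.

Lemma PB_comp A B `{encodable A} `{encodable B} (g : B -> nat) (f : A -> B) :
  PB g -> PB (fun a => esz (f a)) -> PB (fun a => g (f a)).
Proof.
move=> [c gP] fP.
by apply: PB_le (PB_mul (PB_const c) (PB_exp c fP)) => a; apply: gP.
Qed.

Ltac pb := repeat first
  [ assumption | exact: PB_const | exact: PB_esz | apply: PB_add | apply: PB_mul | apply: PB_exp ].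

Definition PT A B `{encodable A} `{encodable B} (f : A -> B) :=
  exists (M : machine) (T : A -> nat),
    (forall a, trans M [:: enc a] [:: enc (f a)] (T a)) /\ PB T.

Lemma PT_ext A B `{encodable A} `{encodable B} (f g : A -> B) : PT g -> f =1 g -> PT f.
Proof. by move=> [M [T [MP TP]]] fg; exists M, T; split=> // a; rewrite fg. Qed.

(** A machine adds at most one bit to its stacks per step, so the running time also bounds the
    output. This is what makes composition work. *)
Lemma PT_size A B `{encodable A} `{encodable B} (f : A -> B) : PT f -> PB (fun a => esz (f a)).
Proof.
move=> [M [T [MP TP]]]; apply: PB_le (PB_add PB_esz TP) => a.
have [x /runs_height] := MP a [::].
by rewrite !flat_cons !cats0 /= !addn0.
Qed.

(** The empty program. It serves changes of type that leave the tree alone, such as reading a number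
    as a list of units or a pair as a nonempty list. *)
Lemma PT_recode A B `{encodable A} `{encodable B} (f : A -> B) :
  (forall a, enc (f a) = enc a) -> PT f.
Proof.
move=> e; exists (mret None), (fun _ => 0); split; last exact: PB_const.
by move=> a; rewrite e; apply: trans_ret.
Qed.

Lemma PT_id A `{encodable A} : PT (fun a : A => a). Proof. exact: PT_recode. Qed.

Lemma PT_comp A B C `{encodable A} `{encodable B} `{encodable C} (g : B -> C) (f : A -> B) :
  PT g -> PT f -> PT (fun a => g (f a)).
Proof.
move=> [M [T [MP TP]]] fP; have sf := PT_size fP; have [M' [T' [MP' TP']]] := fP.
exists (mseq M' M), (fun a => T' a + T (f a)); split; last exact: PB_add TP' (PB_comp TP sf).
by move=> a; apply: trans_seq (MP' a) (MP (f a)).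
Qed.

Lemma PT_pair A B C `{encodable A} `{encodable B} `{encodable C} (f : A -> B) (g : A -> C) :
  PT f -> PT g -> PT (fun a => (f a, g a)).
Proof.
move=> fP gP; have sf := PT_size fP; have sg := PT_size gP.
have [M [T [MP TP]]] := fP; have [M' [T' [MP' TP']]] := gP.
exists (mseq mdup (mseq M (mseq mswap (mseq M' (mseq mswap (mpush iM true)))))).
exists (fun a => 20 * esz a + (T a + (20 * (esz (f a) + esz a) +
   (T' a + (20 * (esz (g a) + esz (f a)) + 1))))); split.
  move=> a; apply: trans_seq (trans_dup _) _.
  apply: trans_seq (trans_frame [:: enc a] (MP a)) _.
  apply: trans_seq (trans_swap _ _) _.
  apply: trans_seq (trans_frame [:: enc (f a)] (MP' a)) _.
  apply: trans_seq (trans_swap _ _) _; exact: trans_cons.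
by pb.
Qed.

Lemma PT_proj1 A B `{encodable A} `{encodable B} : PT (@fst A B).
Proof.
exists (mseq (mpop iM) (mseq mswap mdrop)), (fun p => 1 + (20 * esz p + 10 * esz p)); split.
  case=> a b; apply: trans_seq (trans_uncons _ _) _; apply: trans_seq.
    by apply: trans_weaken (trans_swap _ _) _; rewrite leq_mul2l /= esz_pair leqnSn.
  apply: trans_weaken (trans_frame [:: enc a] (trans_drop _)) _.
  by rewrite leq_mul2l /= esz_pair -/(esz b); lia.
by pb.
Qed.

Lemma PT_proj2 A B `{encodable A} `{encodable B} : PT (@snd A B).
Proof.
exists (mseq (mpop iM) mdrop), (fun p => 1 + 10 * esz p); split.
  case=> a b; apply: trans_seq (trans_uncons _ _) _.
  apply: trans_weaken (trans_frame [:: enc b] (trans_drop _)) _.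
  by rewrite leq_mul2l /= esz_pair -/(esz a); lia.
by pb.
Qed.

Lemma PT_fst E A B `{encodable E} `{encodable A} `{encodable B} (f : E -> A * B) :
  PT f -> PT (fun e => (f e).1).
Proof. by move=> fP; apply: (@PT_comp _ _ _ _ _ _ (@fst A B) f) => //; apply: PT_proj1. Qed.

Lemma PT_snd E A B `{encodable E} `{encodable A} `{encodable B} (f : E -> A * B) :
  PT f -> PT (fun e => (f e).2).
Proof. by move=> fP; apply: (@PT_comp _ _ _ _ _ _ (@snd A B) f) => //; apply: PT_proj2. Qed.

Lemma PT_const A B `{encodable A} `{encodable B} (b : B) : PT (fun _ : A => b).
Proof.
exists (mseq mdrop (mconst (enc b))), (fun a => 10 * esz a + esz b); split.
  by move=> a; apply: trans_seq (trans_drop _) (trans_const _).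
by pb.
Qed.

(** The popped bit is all of an empty list, so only the environment remains for [Mg]. For a nonempty
    list the bit is restored, and swapping and pairing produce the argument of [Mh]. *)
Definition mcase (Mg Mh : machine) := mbind (mpop iM) (fun o => if o is Some true then
  mseq (mpush iM true) (mseq mswap (mseq (mpush iM true) Mh)) else Mg).

Lemma PT_case E A B `{encodable E} `{encodable A} `{encodable B}
    (l : E -> seq A) (g : E -> B) (h : E -> A -> seq A -> B) :
  PT l -> PT g -> PT (fun p : E * (A * seq A) => h p.1 p.2.1 p.2.2) ->
  PT (fun e => match l e with [::] => g e | a :: l' => h e a l' end).
Proof.
move=> lP gP hP; have sl := PT_size lP.
have [Ml [Tl [MlP TlP]]] := lP; have [Mg [Tg [MgP TgP]]] := gP.
have [Mh [Th [MhP [c ThP]]]] := hP.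
exists (mseq mdup (mseq Ml (mcase Mg Mh))).
exists (fun e => 20 * esz e + (Tl e + (Tg e + 20 * (esz (l e) + esz e) + 3 +
  c * (esz e + esz (l e) + 1) ^ c))); split; last first.
  by pb.
move=> e; apply: trans_seq (trans_dup _) _.
apply: trans_seq (trans_frame [:: enc e] (MlP e)) _ => /= z.
case el: (l e) => [|a l'].
  have [x hx] := MgP e z; exists x; rewrite !flat_cons /= -!catA.
  apply: (@runs_weaken _ _ _ _ (1 + Tg e)); last by lia.
  apply: runs_bind (runs_pop _ _) _; rewrite /=.
  by move: hx; rewrite !flat_cons /= -!catA.
have [x hx] : exists x, runs (mseq (mpush iM true) (mseq mswap (mseq (mpush iM true) Mh)))
   (onmain (flat [:: enc a; enc l'; enc e] ++ z)) x (onmain (flat [:: enc (h e a l')] ++ z))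
   (1 + (20 * (esz (a :: l') + esz e) + (1 + c * (esz e + esz (a :: l') + 1) ^ c))).
  move: z; apply: trans_seq (trans_frame [:: enc e] (trans_cons _ _)) _.
  apply: trans_seq (trans_swap _ _) _; apply: trans_seq (trans_cons _ _) _.
  apply: trans_weaken (MhP (e, (a, l'))) _; apply: leq_trans (ThP _) _.
  rewrite leq_mul2l; apply/orP; right; case: (c) => // c'.
  by rewrite leq_exp2r // !esz_pair esz_cons; lia.
exists x; rewrite !flat_cons /= -!catA.
apply: (@runs_weaken _ _ _ _ (1 + (1 + (20 * (esz (a :: l') + esz e) +
   (1 + c * (esz e + esz (a :: l') + 1) ^ c))))); last by lia.
apply: runs_bind (runs_pop _ _) _; rewrite /=.
by move: hx; rewrite !flat_cons /= -!catA.
Qed.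

Lemma PT_app2 E A B C `{encodable E} `{encodable A} `{encodable B} `{encodable C}
  (op : A -> B -> C) (f : E -> A) (g : E -> B) :
  PT (fun p : A * B => op p.1 p.2) -> PT f -> PT g -> PT (fun e => op (f e) (g e)).
Proof. by move=> opP fP gP; apply: (PT_comp opP (PT_pair fP gP)). Qed.

Lemma PT_cons E A `{encodable E} `{encodable A} (f : E -> A) (l : E -> seq A) :
  PT f -> PT l -> PT (fun e => f e :: l e).
Proof. by apply: PT_app2; apply: PT_recode. Qed.

Lemma PT_if E B `{encodable E} `{encodable B} (c : E -> bool) (f g : E -> B) :
  PT c -> PT f -> PT g -> PT (fun e => if c e then f e else g e).
Proof.
move=> cP fP gP.
apply: (@PT_ext _ _ _ _ _ (fun e => match nseq (c e) tt with [::] => g e | _ :: _ => f e end));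
  last by move=> e; case: (c e).
apply: PT_case => //; last by apply: (PT_comp fP); apply: PT_proj1.
by apply: (@PT_comp _ _ _ _ _ _ (fun b : bool => nseq b tt) c) => //; apply: PT_recode => -[].
Qed.

Section Fold.
Context {E A B : Type} `{encodable E} `{encodable A} `{encodable B}.
Variables (l : E -> seq A) (b0 : E -> B) (f : E -> B -> A -> B).

(** The remaining list comes first because [mwhile] tests the first component; the environment
    travels along unchanged. *)
Let step (st : seq A * (B * E)) :=
  match st.1 with
  | [::] => st
  | a :: l' => (l', (f st.2.2 st.2.1 a, st.2.2))
  end.

Lemma iter_step i k e b :
  iter i step (k, (b, e)) = (drop i k, (foldl (f e) b (take i k), e)).
Proof.
elim: i k b => [|i IH] k b; first by rewrite take0 drop0.
by rewrite iterSr; case: k => [|a k] //=; rewrite IH.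
Qed.

Lemma esz_drop i (k : seq A) : esz (drop i k) <= esz k.
Proof.
by elim: k i => [|a k IH] [|i] //=; rewrite esz_cons; apply: leq_trans (IH i) _; lia.
Qed.

(** A polynomial step could still let the accumulator grow exponentially by iteration, hence the
    bound on the values for all prefixes of the list. *)
Lemma PT_foldl_bounded (q : E -> nat) :
  PT l -> PT b0 -> PT (fun p : E * B * A => f p.1.1 p.1.2 p.2) -> PB q ->
  (forall e i, esz (foldl (f e) (b0 e) (take i (l e))) <= q e) ->
  PT (fun e => foldl (f e) (b0 e) (l e)).
Proof.
move=> lP b0P fP qP le_q; have sl := PT_size lP.
have stepP : PT step.
  apply: (@PT_case _ _ _ _ _ _ fst (fun st => st) (fun st a l' => (l', (f st.2.2 st.2.1 a, st.2.2)))).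
  - exact: PT_proj1.
  - exact: PT_id.
  have p2 : PT (fun p : seq A * (B * E) * (A * seq A) => p.1.2.2).
    by do 2 apply: PT_snd; apply: PT_fst; apply: PT_id.
  apply: PT_pair; first by do 2 apply: PT_snd; apply: PT_id.
  apply: PT_pair => //.
  apply: (@PT_comp _ _ _ _ _ _ (fun p : E * B * A => f p.1.1 p.1.2 p.2)
    (fun p : seq A * (B * E) * (A * seq A) => (p.1.2.2, p.1.2.1, p.2.1))) => //.
  apply: PT_pair; first apply: PT_pair => //.
    by apply: PT_fst; apply: PT_snd; apply: PT_fst; apply: PT_id.
  by apply: PT_fst; apply: PT_snd; apply: PT_id.
have initP : PT (fun e => (l e, (b0 e, e))) by do 2 apply: PT_pair => //; apply: PT_id.
have loopP : PT (fun e => iter (size (l e)) step (l e, (b0 e, e))); last first.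
  apply: (@PT_ext _ _ _ _ _ (fun e => (iter (size (l e)) step (l e, (b0 e, e))).2.1)).
    by apply: PT_fst; apply: PT_snd.
  by move=> e; rewrite iter_step /= take_size.
have [Mi [Ti [MiP TiP]]] := initP; have [Ms [Ts [MsP [c TsP]]]] := stepP.
pose (K := fun e : E => c * (esz (l e) + q e + esz e + 2) ^ c).
exists (mseq Mi (mwhile Ms)), (fun e => Ti e + (esz (l e) * (K e + 4) + 4)); split; last first.
  by rewrite /K; pb.
move=> e; apply: trans_seq (MiP e) _.
apply: (@trans_weaken _ _ _ (size (l e) * (K e + 4) + 4)); last first.
  by rewrite leq_add2r leq_mul2r size_esz orbT.
apply: (@trans_while _ (fun i => enc (iter i step (l e, (b0 e, e))))).
- move=> i lt; rewrite iter_step; case ek: (drop i (l e)) => [|a k].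
    by move: lt; rewrite -subn_gt0 -size_drop ek.
  by do 3 eexists.
- by rewrite iter_step drop_size; eexists.
move=> i lt; rewrite iterS; apply: trans_weaken (MsP _) _.
apply: leq_trans (TsP _) _; rewrite /K leq_mul2l; apply/orP; right.
case: (c) => // c'; rewrite leq_exp2r // iter_step !esz_pair.
have := esz_drop i (l e); have := le_q e i; lia.
Qed.

Lemma esz_foldl e b k Q m :
  (forall b a, esz a <= m -> esz (f e b a) <= esz b + Q) -> esz k <= m ->
  esz (foldl (f e) b k) <= esz b + size k * Q.
Proof.
move=> fP; elim: k b => [|a k IH] b; first by rewrite mul0n addn0.
rewrite esz_cons /= => le; apply: leq_trans (IH _ _) _; first by lia.
have := fP b a; rewrite mulSn; lia.
Qed.

Lemma esz_take i (k : seq A) : esz (take i k) <= esz k.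
Proof. by elim: k i => [|a k IH] [|i] //=; rewrite !esz_cons //; have := IH i; lia. Qed.

(** If the growth in one step depends on [e] and [a] but not on the accumulator, the increments add
    up to at most the length of the list times their maximum. *)
Lemma PT_foldl (q : E * A -> nat) :
  PT l -> PT b0 -> PT (fun p : E * B * A => f p.1.1 p.1.2 p.2) -> PB q ->
  (forall e b a, esz (f e b a) <= esz b + q (e, a)) ->
  PT (fun e => foldl (f e) (b0 e) (l e)).
Proof.
move=> lP b0P fP [c qP] le_q; have sl := PT_size lP; have sb := PT_size b0P.
pose (Q := fun e : E => c * (esz e + esz (l e) + 1) ^ c).
apply: (@PT_foldl_bounded (fun e => esz (b0 e) + esz (l e) * Q e)) => //.
  by rewrite /Q; pb.
move=> e i; apply: leq_trans (@esz_foldl _ _ _ (Q e) (esz (l e)) _ _) _.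
- move=> b a le; apply: leq_trans (le_q _ _ _) _; rewrite leq_add2l.
  apply: leq_trans (qP _) _; rewrite leq_mul2l; apply/orP; right.
  by case: (c) => // c'; rewrite leq_exp2r // esz_pair; lia.
- exact: esz_take.
rewrite leq_add2l leq_mul2r; apply/orP; right; apply: leq_trans (size_esz _) _; exact: esz_take.
Qed.
End Fold.

(** * Arithmetic, Boolean and list operations in polynomial time *)

Section NatOps.
Context {E : Type} `{encodable E}.
Implicit Types f g : E -> nat.

Lemma PT_units f : PT f -> PT (fun e => nseq (f e) tt).
Proof.
move=> fP; apply: (@PT_comp _ _ _ _ _ _ (fun n => nseq n tt) f) => //.
by apply: PT_recode; elim=> //= n IH; rewrite -[LHS]/(Node Leaf (enc (nseq n tt))) IH.
Qed.

Lemma PT_succn f : PT f -> PT (fun e => (f e).+1).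
Proof.
move=> fP; apply: (@PT_comp _ _ _ _ _ _ (fun p : unit * nat => p.2.+1) (fun e => (tt, f e))).
  by apply: PT_recode => -[[] n].
by apply: PT_pair => //; apply: PT_const.
Qed.

Lemma PT_predn f : PT f -> PT (fun e => (f e).-1).
Proof.
move=> fP; apply: (@PT_ext _ _ _ _ _ (fun e =>
    size (match nseq (f e) tt with [::] => [::] | _ :: l => l end))).
  apply: (@PT_comp _ _ _ _ _ _ (fun l : seq unit => size l)).
    by apply: PT_recode; elim=> //= a l IH; rewrite -[LHS]/(Node Leaf (enc (size l))) IH; case: a.
  apply: PT_case; first exact: PT_units.
    exact: PT_const.
  by do 2 apply: PT_snd; apply: PT_id.
by move=> e; case: (f e) => //= n; rewrite size_nseq.
Qed.

Lemma PT_iszero f : PT f -> PT (fun e => f e == 0).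
Proof.
move=> fP; apply: (@PT_ext _ _ _ _ _ (fun e =>
    match nseq (f e) tt with [::] => true | _ :: l => false end)).
  by apply: PT_case; [exact: PT_units|exact: PT_const|exact: PT_const].
by move=> e; case: (f e).
Qed.
End NatOps.

Lemma PT_iter E B `{encodable E} `{encodable B} (n : E -> nat) (b0 : E -> B) (f : E -> B -> B)
    (q : E -> nat) :
  PT n -> PT b0 -> PT (fun p : E * B => f p.1 p.2) -> PB q ->
  (forall e b, esz (f e b) <= esz b + q e) ->
  PT (fun e => iter (n e) (f e) (b0 e)).
Proof.
move=> nP bP fP qP le_q.
apply: (@PT_ext _ _ _ _ _ (fun e => foldl (fun b (_ : unit) => f e b) (b0 e) (nseq (n e) tt))).
  apply: (@PT_foldl _ _ _ _ _ _ _ _ (fun e b _ => f e b) (fun p => q p.1)) => //.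
  - exact: PT_units.
  - by apply: PT_comp fP _; apply: PT_fst; apply: PT_id.
  - by apply: PB_comp qP _; apply: PT_size; apply: PT_fst; apply: PT_id.
move=> e; elim: (n e) (b0 e) => //= k IH b.
by rewrite -IH -iterS iterSr.
Qed.

Lemma PT_addn E `{encodable E} (f g : E -> nat) : PT f -> PT g -> PT (fun e => f e + g e).
Proof.
move=> fP gP; apply: (@PT_ext _ _ _ _ _ (fun e => iter (g e) succn (f e))); last first.
  by move=> e; rewrite iter_succn addnC.
apply: (@PT_iter _ _ _ _ _ _ (fun _ n => n.+1) (fun=> 2)) => //.
- by apply: PT_succn; apply: PT_snd; apply: PT_id.
- exact: PB_const.
- by move=> _ b; rewrite !esz_nat; lia.
Qed.

Lemma PT_subn E `{encodable E} (f g : E -> nat) : PT f -> PT g -> PT (fun e => f e - g e).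
Proof.
move=> fP gP; apply: (@PT_ext _ _ _ _ _ (fun e => iter (g e) predn (f e))); last first.
  by move=> e; elim: (g e) => [|n IH] /=; rewrite ?subn0 // subnS IH.
apply: (@PT_iter _ _ _ _ _ _ (fun _ n => n.-1) (fun=> 2)) => //.
- by apply: PT_predn; apply: PT_snd; apply: PT_id.
- exact: PB_const.
- by move=> _ b; rewrite !esz_nat; lia.
Qed.

Lemma PT_muln E `{encodable E} (f g : E -> nat) : PT f -> PT g -> PT (fun e => f e * g e).
Proof.
move=> fP gP; apply: (@PT_ext _ _ _ _ _ (fun e => iter (f e) (addn (g e)) 0)); last first.
  by move=> e; rewrite iter_addn_0 mulnC.
apply: (@PT_iter _ _ _ _ _ _ (fun e n => g e + n) (fun e => esz (g e))) => //.
- exact: PT_const.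
- apply: PT_addn; last by apply: PT_snd; apply: PT_id.
  by apply: PT_comp gP _; apply: PT_fst; apply: PT_id.
- exact: PT_size.
- by move=> e b; rewrite !esz_nat; lia.
Qed.

Section BoolOps.
Context {E : Type} `{encodable E}.

Lemma PT_negb (c : E -> bool) : PT c -> PT (fun e => ~~ c e).
Proof.
move=> cP; apply: (@PT_ext _ _ _ _ _ (fun e => if c e then false else true)) => //.
by apply: PT_if => //; apply: PT_const.
Qed.

Lemma PT_andb (c d : E -> bool) : PT c -> PT d -> PT (fun e => c e && d e).
Proof. by move=> cP dP; apply: PT_if => //; apply: PT_const. Qed.

Lemma PT_orb (c d : E -> bool) : PT c -> PT d -> PT (fun e => c e || d e).
Proof. by move=> cP dP; apply: PT_if => //; apply: PT_const. Qed.

Lemma PT_leq (f g : E -> nat) : PT f -> PT g -> PT (fun e => f e <= g e).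
Proof. by move=> fP gP; apply: PT_iszero; apply: PT_subn. Qed.

Lemma PT_eqn (f g : E -> nat) : PT f -> PT g -> PT (fun e => f e == g e).
Proof.
move=> fP gP; apply: (@PT_ext _ _ _ _ _ (fun e => (f e <= g e) && (g e <= f e))); last first.
  by move=> e; rewrite eqn_leq.
by apply: PT_andb; apply: PT_leq.
Qed.
End BoolOps.

Section SeqOps.
Context {E A : Type} `{encodable E} `{encodable A}.

Lemma PT_behead (l : E -> seq A) : PT l -> PT (fun e => behead (l e)).
Proof.
move=> lP; apply: (@PT_ext _ _ _ _ _ (fun e => match l e with [::] => [::] | _ :: l' => l' end)).
  apply: PT_case => //; first exact: PT_const.
  by do 2 apply: PT_snd; apply: PT_id.
by move=> e; case: (l e).
Qed.

Lemma PT_rev (l : E -> seq A) : PT l -> PT (fun e => rev (l e)).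
Proof.
move=> lP; apply: (@PT_ext _ _ _ _ _ (fun e => foldl (fun acc a => a :: acc) [::] (l e))); last first.
  by move=> e; rewrite /rev; elim: (l e) [::] => //= a k IH acc; rewrite IH.
apply: (@PT_foldl _ _ _ _ _ _ _ _ (fun _ acc a => a :: acc) (fun p => esz p.2 + 1)) => //.
- exact: PT_const.
- by apply: PT_cons; [apply: PT_snd | apply: PT_snd; apply: PT_fst]; apply: PT_id.
- by apply: PB_add; [apply: PT_size; apply: PT_snd; apply: PT_id | apply: PB_const].
- by move=> e b a; rewrite esz_cons /=; lia.
Qed.

Lemma PT_size_seq (l : E -> seq A) : PT l -> PT (fun e => size (l e)).
Proof.
move=> lP; apply: (@PT_ext _ _ _ _ _ (fun e => foldl (fun n (_ : A) => n.+1) 0 (l e))); last first.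
  move=> e; rewrite -[LHS]addn0; elim: (l e) 0 => //= a k IH n.
  by rewrite -IH addnS addSn.
apply: (@PT_foldl _ _ _ _ _ _ _ _ (fun _ n _ => n.+1) (fun p => 2)) => //.
- exact: PT_const.
- by apply: PT_succn; apply: PT_snd; apply: PT_fst; apply: PT_id.
- exact: PB_const.
- by move=> e b a; rewrite !esz_nat; lia.
Qed.

End SeqOps.

Lemma PT_nth E A `{encodable E} `{encodable A} (d : E -> A) (l : E -> seq A) (i : E -> nat) :
  PT d -> PT l -> PT i -> PT (fun e => nth (d e) (l e) (i e)).
Proof.
move=> dP lP iP; apply: (@PT_ext _ _ _ _ _ (fun e =>
   match iter (i e) behead (l e) with [::] => d e | a :: _ => a end)); last first.
  move=> e; elim: (i e) (l e) => [|n IH] k; first by case: k.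
  by rewrite iterSr -IH nth_behead.
apply: PT_case => //; last by apply: PT_fst; apply: PT_snd; apply: PT_id.
apply: (@PT_iter _ _ _ _ _ _ (fun _ l => behead l) (fun=> 0)) => //.
- by apply: PT_behead; apply: PT_snd; apply: PT_id.
- exact: PB_const.
- by move=> _ [|a k] //=; rewrite esz_cons; lia.
Qed.

Section MapFilter.
Context {E A B : Type} `{encodable E} `{encodable A} `{encodable B}.

Lemma PT_map (l : E -> seq A) (f : E -> A -> B) :
  PT l -> PT (fun p : E * A => f p.1 p.2) -> PT (fun e => [seq f e a | a <- l e]).
Proof.
move=> lP fP; apply: (@PT_ext _ _ _ _ _ (fun e =>
    rev (foldl (fun acc a => f e a :: acc) [::] (l e)))); last first.
  move=> e; rewrite -[LHS]revK; congr rev; rewrite /rev.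
  by elim: (l e) [::] => //= a k IH acc; rewrite IH.
apply: PT_rev.
apply: (@PT_foldl _ _ _ _ _ _ _ _ (fun e acc a => f e a :: acc) (fun p => esz (f p.1 p.2) + 1)) => //.
- exact: PT_const.
- apply: PT_cons; last by apply: PT_snd; apply: PT_fst; apply: PT_id.
  apply: (@PT_comp _ _ _ _ _ _ (fun p : E * A => f p.1 p.2) (fun p : E * seq B * A => (p.1.1, p.2))) => //.
  by apply: PT_pair; [do 2 apply: PT_fst | apply: PT_snd]; apply: PT_id.
- by apply: PB_add; [apply: PT_size fP | apply: PB_const].
- by move=> e b a; rewrite esz_cons /=; lia.
Qed.

Lemma PT_filter (l : E -> seq A) (c : E -> A -> bool) :
  PT l -> PT (fun p : E * A => c p.1 p.2) -> PT (fun e => [seq a <- l e | c e a]).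
Proof.
move=> lP cP; apply: (@PT_ext _ _ _ _ _ (fun e =>
    rev (foldl (fun acc a => if c e a then a :: acc else acc) [::] (l e)))); last first.
  move=> e; rewrite -[LHS]revK; congr rev; rewrite /rev.
  by elim: (l e) [::] => //= a k IH acc; rewrite -IH; case: ifP.
apply: PT_rev.
apply: (@PT_foldl _ _ _ _ _ _ _ _ (fun e acc a => if c e a then a :: acc else acc)
  (fun p => esz p.2 + 1)) => //.
- exact: PT_const.
- apply: PT_if; last by apply: PT_snd; apply: PT_fst; apply: PT_id.
    apply: (@PT_comp _ _ _ _ _ _ (fun p : E * A => c p.1 p.2) (fun p : E * seq A * A => (p.1.1, p.2))) => //.
    by apply: PT_pair; [do 2 apply: PT_fst | apply: PT_snd]; apply: PT_id.
  by apply: PT_cons; [apply: PT_snd | apply: PT_snd; apply: PT_fst]; apply: PT_id.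
- by apply: PB_add; [apply: PT_size; apply: PT_snd; apply: PT_id | apply: PB_const].
- by move=> e b a; case: ifP => _; rewrite ?esz_cons /=; lia.
Qed.

(** The pattern of [best] and [find_n]. The accumulator is always the initial value or an entry of
    the list, so its size cannot build up. *)
Lemma PT_select (l : E -> seq A) (b0 : E -> A) (c : E -> A -> A -> bool) :
  PT l -> PT b0 -> PT (fun p : E * A * A => c p.1.1 p.1.2 p.2) ->
  PT (fun e => foldl (fun b a => if c e b a then a else b) (b0 e) (l e)).
Proof.
move=> lP bP cP.
apply: (@PT_foldl _ _ _ _ _ _ _ _ (fun e b a => if c e b a then a else b) (fun p => esz p.2)) => //.
- apply: PT_if => //; first by apply: PT_snd; apply: PT_id.
  by apply: PT_snd; apply: PT_fst; apply: PT_id.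
- by apply: PT_size; apply: PT_snd; apply: PT_id.
- by move=> e b a; case: ifP => _ /=; lia.
Qed.
End MapFilter.

Lemma esz_seq_nat (l : seq nat) m : all (leq^~ m) l -> esz l <= size l * (m.*2 + 2) + 1.
Proof.
elim: l => //= a l IH /andP[am /IH le]; rewrite esz_cons esz_nat mulSn; lia.
Qed.

Lemma PT_iota0 E `{encodable E} (n : E -> nat) : PT n -> PT (fun e => iota 0 (n e)).
Proof.
move=> nP.
have iotaE i : foldl (fun l (_ : unit) => size l :: l) [::] (nseq i tt) = rev (iota 0 i).
  elim: i => // i IH; rewrite -[i.+1]addn1 nseqD foldl_cat IH iotaD rev_cat /=.
  by rewrite size_rev size_iota.
apply: (@PT_ext _ _ _ _ _ (fun e => rev (foldl (fun l (_ : unit) => size l :: l) [::] (nseq (n e) tt))));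
  last by move=> e; rewrite iotaE revK.
apply: PT_rev.
apply: (@PT_foldl_bounded _ _ _ _ _ _ _ _ (fun _ l _ => size l :: l)
  (fun e => esz (n e) * (esz (n e) + 2) + 1)).
- exact: PT_units.
- exact: PT_const.
- by apply: PT_cons; first apply: PT_size_seq; apply: PT_snd; apply: PT_fst; apply: PT_id.
- by have sn := PT_size nP; pb.
- move=> e i.
  have [j le ->] : exists2 j, j <= n e & take i (nseq (n e) tt) = nseq j tt.
    case: (leqP i (n e)) => le; [exists i | exists (n e)] => //; first exact: take_nseq.
    by rewrite take_oversize // size_nseq ltnW.
  rewrite iotaE; apply: leq_trans (@esz_seq_nat _ (n e) _) _.
    by rewrite all_rev; apply/allP => x; rewrite mem_iota /=; lia.
  by rewrite size_rev size_iota esz_nat; nia.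
Qed.

Ltac pt1 := lazymatch goal with
  | |- PT (fun e => e) => apply: PT_id
  | |- PT fst => apply: PT_proj1
  | |- PT snd => apply: PT_proj2
  | |- PT (fun _ => ?c) => apply: PT_const
  | |- PT (fun e => fst _) => apply: PT_fst
  | |- PT (fun e => snd _) => apply: PT_snd
  | |- PT (fun e => (_, _)) => apply: PT_pair
  | |- PT (fun e => _ :: _) => apply: PT_cons
  | |- PT (fun e => if _ then _ else _) => apply: PT_if
  | |- PT (fun e => _ && _) => apply: PT_andb
  | |- PT (fun e => _ || _) => apply: PT_orb
  | |- PT (fun e => ~~ _) => apply: PT_negb
  | |- PT (fun e => _ <= _) => apply: PT_leq
  | |- PT (fun e => _ == _) => apply: PT_eqn
  | |- PT (fun e => S _) => apply: PT_succn
  | |- PT (fun e => predn _) => apply: PT_predn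
  | |- PT (fun e => _ + _) => apply: PT_addn
  | |- PT (fun e => _ - _) => apply: PT_subn
  | |- PT (fun e => _ * _) => apply: PT_muln
  | |- PT (fun e => nth _ _ _) => apply: PT_nth
  | |- PT (fun e => size _) => apply: PT_size_seq
  | |- PT (fun e => rev _) => apply: PT_rev
  | |- PT (fun e => behead _) => apply: PT_behead
  | |- PT (fun e => iota 0 _) => apply: PT_iota0
  | |- PT (fun e => map _ _) => apply: PT_map
  | |- PT (fun e => filter _ _) => apply: PT_filter
  | |- PT (fun e => foldl _ _ _) => apply: PT_select
  | |- PT (fun e => _) => fail
  | |- @PT ?A ?B ?a ?b ?f => change (@PT A B a b (fun e => f e))
  end; cbv beta.
Ltac pt := repeat pt1.

(** * The greedy algorithm *)

(** Sets of players are masks read with default [false]. Rebuilding the whole mask gives it length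
    [n] whatever [a] was, which keeps encodings of size linear in [n]. *)
Definition addm n (a : seq bool) (x : nat) := [seq nth false a i || (i == x) | i <- iota 0 n].
Definition delm n (a : seq bool) (x : nat) := [seq nth false a i && (i != x) | i <- iota 0 n].
Definition elems n (a : seq bool) := [seq x <- iota 0 n | nth false a x].

(* The value is [n] if no [x < n] satisfies [c]. *)
Definition best n (c : pred nat) (R : rel nat) :=
  foldl (fun b x => if c x && ((b == n) || R x b) then x else b) n (iota 0 n).

Section Algorithm.
Variables (n : nat) (D : rel nat).

Definition aff_step (a : seq bool) x y z :=
  if [&& D x y, D y z, D z x, ~~ (nth false a x && nth false a y),
      ~~ (nth false a y && nth false a z) & ~~ (nth false a x && nth false a z)]
  then addm n (addm n (addm n a x) y) z else a.

Definition affected :=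
  foldl (fun a x => foldl (fun a y => foldl (fun a z => aff_step a x y z)
    a (iota 0 n)) a (iota 0 n)) [::] (iota 0 n).

Variables (a : seq bool) (al : seq nat).

Definition weakest_parent (P : seq bool) x :=
  best n (fun p => [&& nth false P p, ~~ nth false a p & D p x]) (fun u v => D v u).

Definition strongest_child (N : seq bool) p :=
  best n (fun x => [&& ~~ nth false N x, ~~ nth false a x & D p x]) D.

(** Every match is verified when it is made, so a flag that is still set at the end certifies the
    bracket by itself. *)
Definition assign (P N : seq bool) (ok : bool) (p x : nat) :=
  (delm n P p, addm n N x, [&& ok, x < n, ~~ nth false N x, (p < n) && nth false P p & D p x]).

(* Entry [i] of the guess [g] is the round in which the [i]-th affected player loses, and
   entry [size al + i] is the index in [al] of the player who beats it; an index out of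
   range stands for an unaffected player. *)
Definition phase1 (g : seq nat) (t : nat) (st : seq bool * seq bool * bool) (i : nat) :=
  if nth 0 g i == t then
    assign st.1.1 st.1.2 st.2
      (if nth n al (nth 0 g (size al + i)) < n then nth n al (nth 0 g (size al + i))
       else weakest_parent st.1.1 (nth n al i)) (nth n al i)
  else st.

Definition phase2 (st : seq bool * bool) (p : nat) :=
  (addm n st.1 (strongest_child st.1 p),
   [&& st.2, strongest_child st.1 p < n, ~~ nth false st.1 (strongest_child st.1 p)
     & D p (strongest_child st.1 p)]).

(** Both masks start as the current survivors. The first loses each player who has received an
    opponent, the second gains the opponents. Affected losers are placed first; whoever is then left
    in the first mask gets an unaffected opponent. *)
Definition round (g : seq nat) (st : seq bool * bool) (t : nat) :=
  foldl phase2
   ((foldl (phase1 g t.+1) (st.1, st.1, st.2) (iota 0 (size al))).1.2,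
    (foldl (phase1 g t.+1) (st.1, st.1, st.2) (iota 0 (size al))).2)
   (elems n (foldl (phase1 g t.+1) (st.1, st.1, st.2) (iota 0 (size al))).1.1).

Definition check (start : seq bool) (k : nat) (g : seq nat) :=
  (foldl (round g) (start, true) (iota 0 k)).2.
End Algorithm.

Section Masks.
Variable n : nat.
Implicit Types a : seq bool.

Lemma nth_addm a x y : y < n -> nth false (addm n a x) y = nth false a y || (y == x).
Proof. by move=> lt; rewrite (nth_map 0) ?size_iota // nth_iota. Qed.
Lemma nth_delm a x y : y < n -> nth false (delm n a x) y = nth false a y && (y != x).
Proof. by move=> lt; rewrite (nth_map 0) ?size_iota // nth_iota. Qed.
Lemma mem_elems a x : (x \in elems n a) = (x < n) && nth false a x.
Proof. by rewrite mem_filter mem_iota /= add0n andbC. Qed.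
Lemma uniq_elems a : uniq (elems n a). Proof. exact: filter_uniq (iota_uniq _ _). Qed.

Lemma perm_elems_add a x : x < n -> ~~ nth false a x ->
  perm_eq (elems n (addm n a x)) (x :: elems n a).
Proof.
move=> lt na; apply: uniq_perm; rewrite /= ?uniq_elems ?mem_elems ?andbT //.
  by rewrite (negbTE na) andbF.
move=> y; rewrite inE !mem_elems; case: (ltnP y n) => [lty|ley] /=.
  by rewrite nth_addm // orbC.
by case: eqP => // e; move: ley; rewrite e leqNgt lt.
Qed.

Lemma perm_elems_del a x : x < n -> nth false a x ->
  perm_eq (x :: elems n (delm n a x)) (elems n a).
Proof.
move=> lt na; apply: uniq_perm; rewrite /= ?uniq_elems ?mem_elems ?andbT //.
  by rewrite lt nth_delm // eqxx andbF.
move=> y; rewrite inE !mem_elems; case: (ltnP y n) => [lty|ley] /=.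
  by rewrite nth_delm //; case: eqP => [->|] //=; rewrite ?na ?andbT.
by case: eqP => // e; move: ley; rewrite e leqNgt lt.
Qed.
End Masks.

(** * Soundness: an accepted guess yields a seeding *)

Lemma perm_unzip1_lift (S T : eqType) (L : seq (S * T)) s :
  perm_eq (unzip1 L) s -> exists2 L', perm_eq L' L & unzip1 L' = s.
Proof.
elim: s L => [|x s IH] L.
  by move/perm_nilP => e; exists [::] => //; case: L e.
move=> pe; have : x \in unzip1 L by rewrite (perm_mem pe) mem_head.
case/mapP=> p pL ex; have pr := perm_to_rem pL.
have [L' pL' e'] : exists2 L', perm_eq L' (rem p L) & unzip1 L' = s.
  apply: IH; rewrite -(perm_cons x) -(permPr pe) ex.
  by rewrite perm_sym; apply: (perm_map fst pr).
exists (p :: L'); last by rewrite /= e' ex.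
by rewrite perm_sym; apply: perm_trans pr _; rewrite perm_cons perm_sym.
Qed.

Lemma ko_round_cat2 (T : eqType) (D : rel T) (L : seq (T * T)) : all (fun p => D p.1 p.2) L ->
  ko_round D (flatten [seq [:: p.1; p.2] | p <- L]) = unzip1 L.
Proof. by elim: L => //= p L IH /andP[-> /IH ->]. Qed.

Lemma perm_flatten_pairs (T : eqType) (L : seq (T * T)) :
  perm_eq (flatten [seq [:: p.1; p.2] | p <- L]) (unzip1 L ++ unzip2 L).
Proof.
elim: L => //= p L /permP IH; apply/permP => q /=; have := IH q.
by rewrite !count_cat /=; lia.
Qed.

(** The matches of a round come in no particular order. Sorting them along [s] and putting each
    loser right after its winner gives the leaves one level further down. *)
Lemma reseed (T : eqType) (D : rel T) (L : seq (T * T)) s :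
  perm_eq (unzip1 L) s -> all (fun p => D p.1 p.2) L ->
  exists2 s', perm_eq s' (s ++ unzip2 L) & ko_round D s' = s.
Proof.
move=> /perm_unzip1_lift[L' pL e] aL; exists (flatten [seq [:: p.1; p.2] | p <- L']).
  apply: perm_trans (perm_flatten_pairs _) _; rewrite e perm_cat2l; exact: perm_map.
by rewrite ko_round_cat2 // (perm_all _ pL).
Qed.

Section Soundness.
Variables (n : nat) (D : rel nat) (a : seq bool) (al : seq nat).

Lemma phase1_sound g t alive ok l :
  (foldl (phase1 n D a al g t) (alive, alive, ok) l).2 ->
  ok /\ exists L, [/\ all (fun p => D p.1 p.2) L,
    perm_eq (unzip1 L ++ elems n (foldl (phase1 n D a al g t) (alive, alive, ok) l).1.1) (elems n alive) &
    perm_eq (elems n (foldl (phase1 n D a al g t) (alive, alive, ok) l).1.2) (elems n alive ++ unzip2 L)].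
Proof.
elim/last_ind: l => [|l i IH] /=; first by move=> okT; split=> //; exists [::]; rewrite cats0.
rewrite foldl_rcons; set st := foldl _ _ l in IH *.
rewrite /phase1; case: ifP => // _; set p := (X in assign _ _ _ _ _ X _); set x := nth n al i.
rewrite /assign /= => /and5P[okT ltx nx /andP[ltp Pp] Dpx].
have [ok0 [L [aL p1 p2]]] := IH okT; split=> //; exists ((p, x) :: L); split.
- by rewrite /= Dpx.
- apply: perm_trans p1.
  apply/permP => q; have /permP/(_ q) := perm_elems_del ltp Pp.
  by rewrite /= !count_cat /=; lia.
- apply: perm_trans (perm_elems_add ltx nx) _; apply/permP => q; have /permP/(_ q) := p2.
  by rewrite /= !count_cat /=; lia.
Qed.

Lemma phase2_sound N ok l :
  (foldl (phase2 n D a) (N, ok) l).2 ->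
  ok /\ exists L, [/\ all (fun p => D p.1 p.2) L, unzip1 L = l &
    perm_eq (elems n (foldl (phase2 n D a) (N, ok) l).1) (elems n N ++ unzip2 L)].
Proof.
elim/last_ind: l => [|l p IH] /=; first by move=> okT; split=> //; exists [::]; rewrite cats0.
rewrite foldl_rcons; set st := foldl _ _ l in IH *.
rewrite /phase2; set x := strongest_child _ _ _ _ _ => /= /and4P[okT ltx nx Dpx].
have [ok0 [L [aL p1 p2]]] := IH okT; split=> //; exists (rcons L (p, x)); split.
- by rewrite all_rcons /= Dpx.
- by rewrite /unzip1 map_rcons -/(unzip1 L) p1.
- apply: perm_trans (perm_elems_add ltx nx) _; apply/permP => q; have /permP/(_ q) := p2.
  by rewrite /unzip2 map_rcons -cats1 /= !count_cat /=; lia.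
Qed.

Lemma round_sound g st t : (round n D a al g st t).2 ->
  st.2 /\ exists L, [/\ all (fun p => D p.1 p.2) L, perm_eq (unzip1 L) (elems n st.1) &
    perm_eq (elems n (round n D a al g st t).1) (elems n st.1 ++ unzip2 L)].
Proof.
rewrite /round => /phase2_sound[/phase1_sound[ok [L1 [a1 p1 q1]]] [L2 [a2 p2 q2]]].
split=> //; exists (L1 ++ L2); rewrite all_cat a1 a2; split=> //.
  by rewrite /unzip1 map_cat -/(unzip1 L1) -/(unzip1 L2) p2.
apply: perm_trans q2 _; apply/permP => q; have /permP/(_ q) := q1.
by rewrite /unzip2 map_cat !count_cat /=; lia.
Qed.

Lemma check_sound start k g v : elems n start = [:: v] -> n = 2 ^ k ->
  check n D a al start k g ->
  exists2 s, perm_eq s (iota 0 n) & iter k (ko_round D) s = [:: v].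
Proof.
move=> es en; rewrite /check.
have inv i : (foldl (round n D a al g) (start, true) (iota 0 i)).2 ->
    exists2 s, perm_eq s (elems n (foldl (round n D a al g) (start, true) (iota 0 i)).1) &
      size s = 2 ^ i /\ iter i (ko_round D) s = [:: v].
  elim: i => [|i IH]; first by move=> _; exists [:: v]; rewrite /= ?es.
  rewrite -[i.+1]addn1 iotaD foldl_cat /= add0n => /round_sound[/IH[s ps [ss its]] [L [aL p1 p2]]].
  have p1s : perm_eq (unzip1 L) s by apply: perm_trans p1 _; rewrite perm_sym.
  have [s' ps' ks'] := reseed p1s aL; exists s'.
    apply: perm_trans ps' _; rewrite perm_sym; apply: perm_trans p2 _.
    by rewrite perm_cat2r perm_sym.
  rewrite addn1 iterSr ks' its; split=> //.
  rewrite (perm_size ps') size_cat /unzip2 size_map -(size_map fst) (perm_size p1).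
  by rewrite -(perm_size ps) ss expnS; lia.
move/inv => [s ps [ss its]]; exists s => //; apply: perm_trans (ps) _.
(* A sublist of [iota 0 n] with [2 ^ k = n] entries is the whole list. *)
set e := elems n _ in ps *; suff -> : e = iota 0 n by [].
apply/eqP; rewrite -(size_subseq_leqif (filter_subseq _ _)) -(perm_size ps) ss.
by rewrite size_iota en.
Qed.
End Soundness.

(** * Completeness of the guesses *)

(** Totality and transitivity are asked of candidates only, since the tournament is a linear order
    just on the unaffected players. *)
Lemma bestP n (c : pred nat) (R : rel nat) y :
  (forall u v, c u -> c v -> u < n -> v < n -> u != v -> R u v || R v u) ->
  (forall u v w, c u -> c v -> c w -> u < n -> v < n -> w < n ->
     R u v -> R v w -> R u w) ->
  y < n -> c y -> [/\ best n c R < n, c (best n c R) & best n c R = y \/ R (best n c R) y].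
Proof.
move=> Rtot Rtr lty cy; rewrite /best.
set f := fun b x => _.
have inv i : i <= n -> let r := foldl f n (iota 0 i) in
    (r = n /\ forall z, z < i -> ~~ c z) \/
    [/\ r < n, c r & forall z, z < i -> c z -> r = z \/ R r z].
  elim: i => [|i IH] lei; first by left.
  rewrite -[i.+1]addn1 iotaD foldl_cat /= add0n addn1; set r := foldl f n (iota 0 i) in IH *.
  rewrite /f; case: (IH (ltnW lei)) => [[er nc]|[ltr cr rP]].
    rewrite er eqxx /= andbT; case: ifP => ci.
      by right; split=> // z; rewrite ltnS leq_eqVlt => /predU1P[->|/nc/negbTE->]; auto.
    by left; split=> // z; rewrite ltnS leq_eqVlt => /predU1P[->|/nc//]; rewrite ci.
  rewrite (ltn_eqF ltr) /=; case: ifP => [/andP[ci Ri]|nci].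
    right; split=> // z; rewrite ltnS leq_eqVlt => /predU1P[->|ltz cz]; first by left.
    have ltzn : z < n by lia.
    by case: (rP z ltz cz) => [<-|Rrz]; right=> //; apply: (Rtr i r z).
  right; split=> // z; rewrite ltnS leq_eqVlt => /predU1P[-> ci|/rP//].
  case: (eqVneq r i) => [|ne]; first by left.
  by right; move: (Rtot _ _ cr ci ltr lei ne); move: nci; rewrite ci /= => ->; rewrite orbF.
case: (inv n (leqnn n)) => [[_ /(_ y lty)]|[? ? rP]]; first by rewrite cy.
by split=> //; apply: rP.
Qed.

Section Completeness.
Variables (n k v : nat) (D : rel nat).
Hypothesis Dtot : forall x y, x < n -> y < n -> x != y -> D x y = ~~ D y x.
Hypothesis Dirr : forall x, ~~ D x x.
Hypothesis ltv : v < n.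

(* [tau y] is the round, counted from the final, in which [y] loses to [pi y];
   [s_inj] and [s_ex] say that each survivor beats exactly one player per round. *)
Record sol (tau pi : nat -> nat) : Prop := Sol {
  s_root : tau v = 0;
  s_par : forall y, y < n -> y != v ->
    [/\ pi y < n, tau (pi y) < tau y, tau y <= k & D (pi y) y];
  s_inj : forall y z, y < n -> z < n -> y != v -> z != v ->
    pi y = pi z -> tau y = tau z -> y = z;
  s_ex : forall x t, x < n -> tau x < t -> t <= k ->
    exists y, [/\ y < n, y != v, pi y = x & tau y = t] }.

Variables (a : seq bool).
Notation U x := (~~ nth false a x).
Hypothesis noTri : forall x y z, x < n -> y < n -> z < n -> U x -> U y ->
  D x y -> D y z -> ~~ D z x.

(** Otherwise [x], [y], [z] would be a triangle with two vertices outside [a]. The player [z] may be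
    affected. *)
Lemma U_beats x y z : x < n -> y < n -> z < n -> U x -> U y -> D x y -> D y z -> D x z.
Proof.
move=> ltx lty ltz Ux Uy Dxy Dyz; have nzx := noTri ltx lty ltz Ux Uy Dxy Dyz.
case: (eqVneq x z) => [e|ne]; last by rewrite Dtot.
have nxy : x != y by apply/eqP => e'; move: Dxy; rewrite e' (negbTE (Dirr _)).
by move: Dxy; rewrite Dtot // e Dyz.
Qed.

Lemma U_beaten p x y : p < n -> x < n -> y < n -> U x -> U y -> D p x -> D x y -> D p y.
Proof.
move=> ltp ltx lty Ux Uy Dpx Dxy.
case: (eqVneq p y) => [e|ne].
  have nxy : x != y by apply/eqP => e'; move: Dxy; rewrite e' (negbTE (Dirr _)).
  by move: Dxy; rewrite Dtot // -e Dpx.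
rewrite Dtot //; apply/negP => Dyp.
by have := noTri ltx lty ltp Ux Uy Dxy Dyp; rewrite Dpx.
Qed.

Definition transp x y z : nat := if z == x then y else if z == y then x else z.
(** Only the opponents of [y] in rounds up to [tau x] change hands. In the rounds beyond, which are
    played earlier, [x] and [y] each keep their own. *)
Definition regraft (tau pi : nat -> nat) x y w : nat :=
  if (pi w == y) && (tau w <= tau x) then x else pi w.

Lemma transpK x y : involutive (transp x y).
Proof.
move=> z; rewrite /transp; case: (eqVneq z x) => [->|nx].
  by rewrite eqxx; case: eqP.
case: (eqVneq z y) => [->|ny]; first by rewrite eqxx.
by rewrite (negbTE nx) (negbTE ny).
Qed.

Lemma transp_fix x y z : z != x -> z != y -> transp x y z = z.
Proof. by rewrite /transp => /negbTE-> /negbTE->. Qed.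
Lemma transpL x y : transp x y x = y. Proof. by rewrite /transp eqxx. Qed.
Lemma transpR x y : transp x y y = x.
Proof. by rewrite /transp eqxx; case: eqP. Qed.

(* [x] takes the place of [y] in the bracket together with the opponents
   that [y] meets no later (from the final) than [x] is eliminated. *)
Lemma sol_exchange tau pi x y : sol tau pi -> x < n -> y < n -> U x -> U y ->
  D x y -> y != v -> tau y <= tau x -> D (pi y) x ->
  sol (fun z => tau (transp x y z)) (fun z => regraft tau pi x y (transp x y z)).
Proof.
move=> [root par inj ex] ltx lty Ux Uy Dxy nyv le_t Dpx.
have [ltpy tpy tyk Dpy] := par y lty nyv.
have nxv : x != v by apply/eqP => e; move: le_t; rewrite e root; lia.
have nxy : x != y by apply/eqP => e'; move: Dxy; rewrite e' (negbTE (Dirr _)).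
have [ltpx tpx txk Dpx'] := par x ltx nxv.
have lt_tr z : z < n -> transp x y z < n by rewrite /transp; do 2 case: ifP => //.
have tr_v z : (transp x y z == v) = (z == v).
  rewrite /transp; case: (eqVneq z x) => [->|_]; first by rewrite (negbTE nyv) (negbTE nxv).
  by case: (eqVneq z y) => [->|_] //; rewrite (negbTE nyv) (negbTE nxv).
(* Here [w] names a slot of the old bracket, now occupied by [transp x y w]. *)
have gen w : w < n -> w != v -> [/\ regraft tau pi x y w < n,
    tau (transp x y (regraft tau pi x y w)) < tau w, tau w <= k &
    D (regraft tau pi x y w) (transp x y w)].
  move=> ltw nwv; have [ltpw tpw twk Dpw] := par w ltw nwv.
  rewrite /regraft; case: (eqVneq (pi w) y) => [epw|npw] /=.
    case: (leqP (tau w) (tau x)) => [le|gt] /=; rewrite ?transpL.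
      split=> //; first by rewrite -epw.
      case: (eqVneq w x) => [->|nwx]; first by rewrite transpL.
      have nwy : w != y by apply/eqP => e; move: tpw; rewrite epw e ltnn.
      by rewrite transp_fix //; apply: (U_beats ltx lty) => //; rewrite -epw.
    rewrite epw transpR; split=> //.
    have nwx : w != x by apply/eqP => e; move: gt; rewrite e ltnn.
    have nwy : w != y by apply/eqP => e; move: tpw; rewrite epw e ltnn.
    by rewrite transp_fix // -epw.
  split=> //.
    case: (eqVneq (pi w) x) => [epw|npx]; last by rewrite transp_fix.
    by rewrite epw transpL; apply: leq_ltn_trans le_t _; rewrite -epw.
  case: (eqVneq w x) => [e|nwx].
    (* [y] moves into the slot of [x], and whoever beats [x] also beats [y]. *)
    by rewrite e transpL; apply: (U_beaten _ ltx lty).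
  case: (eqVneq w y) => [e|nwy]; first by rewrite e transpR.
  by rewrite transp_fix.
split.
- by rewrite transp_fix // eq_sym.
- move=> z ltz nzv; have := gen (transp x y z); rewrite transpK tr_v => /(_ (lt_tr _ ltz) nzv).
  by case.
- move=> z w ltz ltw nzv nwv eh et; apply: (can_inj (transpK x y)).
  apply: inj; rewrite ?tr_v ?lt_tr //.
  move: eh et; rewrite /regraft.
  set z' := transp x y z; set w' := transp x y w.
  have [ltpz tpz tzk Dpz] : [/\ pi z' < n, tau (pi z') < tau z', tau z' <= k & D (pi z') z'].
    by apply: par; rewrite ?tr_v ?lt_tr.
  have [ltpw tpw twk Dpw] : [/\ pi w' < n, tau (pi w') < tau w', tau w' <= k & D (pi w') w'].
    by apply: par; rewrite ?tr_v ?lt_tr.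
  case: (eqVneq (pi z') y) => [ez|nz] /=; case: (eqVneq (pi w') y) => [ew|nw] //=.
  + by rewrite ez ew.
  (* Opponents taken over from [y] lose in rounds up to [tau x], those [x] had before in later ones,
     so no two share a round. *)
  + case: (leqP (tau z') (tau x)) => [le e et|_ ->] //; move: tpw; rewrite -e -et; lia.
  + case: (leqP (tau w') (tau x)) => [le e et|_ <-] //; move: tpz; rewrite e et; lia.
- move=> z t ltz; case: (eqVneq z x) => [->|nzx].
    rewrite transpL => tyt tk; case: (leqP t (tau x)) => [le|gt].
      have [w [ltw nwv ew tw]] := ex y t lty tyt tk.
      exists (transp x y w); rewrite lt_tr // tr_v transpK /regraft ew eqxx tw le; split=> //.
    have [w [ltw nwv ew tw]] := ex x t ltx gt tk.
    by exists (transp x y w); rewrite lt_tr // tr_v transpK /regraft ew (negbTE nxy).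
  case: (eqVneq z y) => [->|nzy].
    rewrite transpR => txt tk.
    have [w [ltw nwv ew tw]] := ex y t lty (leq_ltn_trans le_t txt) tk.
    by exists (transp x y w); rewrite lt_tr // tr_v transpK /regraft ew eqxx tw leqNgt txt.
  rewrite transp_fix // => tzt tk.
  have [w [ltw nwv ew tw]] := ex z t ltz tzt tk.
  by exists (transp x y w); rewrite lt_tr // tr_v transpK /regraft ew (negbTE nzy).
Qed.

(** Players who lose in the same round head brackets of equal depth, so they can trade places
    together with everything below them, and only the two matches above need checking. *)
Lemma sol_swap_children tau pi x z p q : sol tau pi -> x < n -> z < n -> x != v -> z != v ->
  pi x = q -> pi z = p -> tau x = tau z -> D p x -> D q z ->
  sol tau (fun w => if w == x then p else if w == z then q else pi w).
Proof.
move=> [root par inj ex] ltx ltz nxv nzv ex' ez' et Dpx Dqz.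
have [ltq tq xk Dqx] := par x ltx nxv; have [ltp tp zk Dpz] := par z ltz nzv.
rewrite ex' in ltq tq Dqx; rewrite ez' in ltp tp Dpz.
split=> //.
- move=> y lty nyv; case: (eqVneq y x) => [->|nyx]; first by rewrite et; split=> //; rewrite -et.
  case: (eqVneq y z) => [->|nyz]; first by rewrite -et; split=> //; rewrite et.
  exact: par.
- have e w : (if w == x then p else if w == z then q else pi w) = pi (transp x z w).
    by rewrite /transp; case: eqP => // _; case: eqP.
  move=> y w lty ltw nyv nwv; rewrite !e => epi etw; apply: (can_inj (transpK x z)).
  have te u : tau (transp x z u) = tau u.
    by rewrite /transp; case: eqP => [->|_] //; case: eqP => [->|].
  have lt_tr u : u < n -> transp x z u < n by rewrite /transp; do 2 case: ifP => //.
  have tr_v u : u != v -> transp x z u != v by rewrite /transp; do 2 case: ifP => //.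
  by apply: inj; rewrite ?te ?lt_tr ?tr_v.
- move=> y t lty tyt tk; have [w [ltw nwv ew tw]] := ex y t lty tyt tk.
  case: (eqVneq w x) => [ewx|nwx].
    exists z; split; rewrite // ?eqxx.
      by case: eqP => [e|_]; [rewrite -ew ewx ex' -ez' e|rewrite -ew ewx ex'].
    by rewrite -et -ewx.
  case: (eqVneq w z) => [ewz|nwz].
    by exists x; split; rewrite // ?eqxx // ?et -?ewz // -ew ewz.
  by exists w; rewrite (negbTE nwx) (negbTE nwz).
Qed.

Let al := elems n a.
Let m := size al.

Definition agree (g : seq nat) (tau pi : nat -> nat) := forall i, i < m ->
  tau (nth n al i) = nth 0 g i /\
  (nth n al i != v ->
    if nth n al (nth 0 g (m + i)) < n then pi (nth n al i) = nth n al (nth 0 g (m + i))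
    else U (pi (nth n al i))).

Lemma al_lt i : i < m -> nth n al i < n /\ nth false a (nth n al i).
Proof. by move=> lt; have := mem_nth n lt; rewrite mem_elems => /andP. Qed.

Lemma al_nth x : x < n -> nth false a x -> exists2 i, i < m & nth n al i = x.
Proof.
move=> ltx ax; have xa : x \in al by rewrite mem_elems ltx.
by exists (index x al); rewrite ?index_mem ?nth_index.
Qed.

(** A guess does not say which unaffected player beats a given affected one, so replacing one
    unaffected victor by another respects it. *)
Lemma agree_eq g tau pi tau' pi' : agree g tau pi ->
  (forall w, w < n -> nth false a w ->
    tau' w = tau w /\ (pi' w = pi w \/ U (pi w) && U (pi' w))) ->
  agree g tau' pi'.
Proof.
move=> ag eqP i lti; have [et eg] := ag i lti; have [ltx ax] := al_lt lti.
have [-> ep] := eqP _ ltx ax; split=> // nv; move: (eg nv).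
case: ifP => ltb; last by case: ep => [->|/andP[]].
case: ep => [->|/andP[Up Up'] e] //.
have lti' : nth 0 g (m + i) < m.
  by rewrite ltnNge; apply/negP => le; move: ltb; rewrite nth_default // ltnn.
by have [_] := al_lt lti'; move: Up; rewrite e => /negbTE->.
Qed.

Section Round.
Variables (g : seq nat) (t : nat).
Hypothesis t_gt0 : 0 < t.
Hypothesis t_le : t <= k.

Lemma tau_root tau pi y : sol tau pi -> tau y = t -> y != v.
Proof. by move=> so e; apply/eqP => ev; move: e t_gt0; rewrite ev (s_root so) => <-. Qed.

(** The solution is existential because it is replaced whenever the greedy choice differs from it. A
    loser of round [t] has been placed exactly when its victor has left the first mask. *)
Definition inv1 i (st : seq bool * seq bool * bool) := exists tau pi,
  [/\ sol tau pi /\ agree g tau pi, st.2,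
   (forall p, p < n -> nth false st.1.1 p -> tau p < t),
   (forall y, y < n -> nth false st.1.2 y =
      (tau y < t) || ((tau y == t) && ~~ nth false st.1.1 (pi y))) &
   (forall j, j < m -> nth 0 g j = t -> nth false st.1.2 (nth n al j) = (j < i))].

Lemma inv1_step i st : i < m -> inv1 i st -> inv1 i.+1 (phase1 n D a al g t st i).
Proof.
case: st => [[P N] ok] lti [tau [pi [[so ag] /= okT Pt NE NA]]].
rewrite /phase1 -/m /=; case: eqP => [eg|ng]; last first.
  exists tau, pi; split=> // j ltj ej; rewrite NA // ltnS [RHS]leq_eqVlt.
  by case: eqP => // e; case: ng; rewrite -e.
set x := nth n al i; have [ltx ax] := al_lt lti.
have Nx : ~~ nth false N x by rewrite NA // ltnn.
have [etx agx] := ag i lti; rewrite -/x eg in etx agx.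
have nxv := tau_root so etx.
have [ltq tq _ Dqx] := s_par so ltx nxv.
have Pq : nth false P (pi x) by move: Nx; rewrite NE // etx ltnn eqxx /= negbK.
have [p [pi' [ep so' ag' Ppi' pxp]]] : exists p pi', [/\
    (if nth n al (nth 0 g (m + i)) < n then nth n al (nth 0 g (m + i))
     else weakest_parent n D a P x) = p, sol tau pi', agree g tau pi',
    (forall y, y < n -> tau y = t -> nth false P (pi' y) = nth false P (pi y)) & pi' x = p].
  move: (agx nxv); case: ifP => _ e; first by exists (pi x), pi; split.
  exists (weakest_parent n D a P x).
  have [|||ltp /and3P[Pp Up Dpx] cmp] := @bestP n
     (fun p => [&& nth false P p, U p & D p x]) (fun u w => D w u) (pi x) _ _ ltq _.
  - by move=> u w _ _ ltu ltw nuw; rewrite (Dtot ltw ltu) ?orNb // eq_sym.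
  - move=> u w z /and3P[_ Uu _] /and3P[_ Uw _] /and3P[_ Uz _] ltu ltw ltz Dwu Dzw.
    exact: (U_beats ltz ltw ltu).
  - by rewrite Pq e.
  rewrite -/(weakest_parent n D a P x) in ltp Pp Up Dpx cmp.
  set p := weakest_parent n D a P x in ltp Pp Up Dpx cmp *.
  case: cmp => [ep|Dqp]; first by exists pi; rewrite -ep.
  (* In the solution the weakest candidate [p] beats some [z] in this round. The player [pi x] beats
     [p], hence also [z], so [x] and [z] can trade victors. *)
  have [z [ltz nzv ez tz]] := s_ex so ltp (Pt p ltp Pp) t_le.
  have [_ _ _ Dpz] := s_par so ltz nzv; rewrite ez in Dpz.
  exists (fun w => if w == x then p else if w == z then pi x else pi w); split=> //.
  - apply: sol_swap_children => //; first by rewrite tz.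
    exact: (U_beats ltq ltp ltz).
  - apply: agree_eq ag _ => w ltw aw; split=> //.
    case: (eqVneq w x) => [->|_]; first by right; rewrite e Up.
    by case: (eqVneq w z) => [->|_]; [right; rewrite ez Up e | left].
  - move=> y lty ty; case: (eqVneq y x) => [->|_]; first by rewrite Pp Pq.
    by case: (eqVneq y z) => [->|_] //; rewrite ez Pp Pq.
  - by rewrite eqxx.
have [ltp tp _ Dpx] := s_par so' ltx nxv; rewrite pxp in ltp tp Dpx.
have Pp : nth false P p by rewrite -pxp Ppi' // Pq.
rewrite ep /assign; exists tau, pi'; split=> //=.
- by rewrite okT ltx Nx ltp Pp Dpx.
- by move=> u ltu; rewrite nth_delm // => /andP[/(Pt _ ltu)].
- move=> y lty; rewrite nth_addm // NE //; case: (ltngtP (tau y) t) => //= ty.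
    by apply/eqP => e; move: ty; rewrite e etx ltnn.
  have nyv := tau_root so ty; have [ltpy _ _ _] := s_par so' lty nyv.
  rewrite nth_delm // negb_and negbK Ppi' //; congr (_ || _).
  apply/eqP/eqP => [->//|epy]; apply: (s_inj so') => //; by rewrite ?ty ?pxp.
- move=> j ltj ej; have [ltj' _] := al_lt ltj; rewrite nth_addm // NA // ltnS [RHS]leq_eqVlt orbC.
  by rewrite nth_uniq // uniq_elems.
Qed.

(** [rem] lists the survivors still without an opponent. By the last clause all affected losers of
    round [t] are placed, so every opponent still missing is unaffected. *)
Definition inv2 (rem : seq nat) (st : seq bool * bool) := exists tau pi,
  [/\ sol tau pi /\ agree g tau pi, st.2,
   (forall p, p \in rem -> p < n /\ tau p < t),
   (forall y, y < n -> nth false st.1 y = (tau y < t) || ((tau y == t) && (pi y \notin rem))) &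
   (forall y, y < n -> nth false a y -> tau y = t -> nth false st.1 y)].

Lemma inv2_step p rem st : uniq (p :: rem) -> inv2 (p :: rem) st -> inv2 rem (phase2 n D a st p).
Proof.
case: st => [N ok] /= /andP[nprem _] [tau [pi [[so ag] /= okT remP NE NA]]].
have [ltp tp] := remP p (mem_head _ _).
have [y [lty nyv ey ty]] := s_ex so ltp tp t_le.
have Ny : ~~ nth false N y by rewrite NE // ty ltnn eqxx ey mem_head.
have Uy : U y by apply: contra Ny => ay; apply: NA.
have [_ _ _ Dpy] := s_par so lty nyv; rewrite ey in Dpy.
have [|||ltx /and3P[Nx Ux Dpx] cmp] := @bestP n
   (fun x => [&& ~~ nth false N x, U x & D p x]) D y _ _ lty _.
- by move=> u w _ _ ltu ltw nuw; rewrite (Dtot ltu ltw) // orNb.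
- move=> u w z /and3P[_ Uu _] /and3P[_ Uw _] /and3P[_ Uz _] ltu ltw ltz Duw Dwz.
  exact: (U_beats ltu ltw ltz).
- by rewrite Ny Uy.
rewrite -/(strongest_child n D a N p) in ltx Nx Ux Dpx cmp.
rewrite /phase2 /=; set x := strongest_child n D a N p in ltx Nx Ux Dpx cmp *.
(* With [tau y = t] this is the condition [tau y <= tau x] of [sol_exchange], which puts the greedy
   choice [x] into the slot of [y]. *)
have tx : t <= tau x by move: Nx; rewrite NE // negb_or -leqNgt => /andP[].
have [tau' [pi' [so' ag' remP' NE' [NA' tx' px']]]] : exists tau' pi', [/\
   sol tau' pi', agree g tau' pi', (forall p', p' \in p :: rem -> p' < n /\ tau' p' < t),
   (forall y, y < n -> nth false N y = (tau' y < t) || ((tau' y == t) && (pi' y \notin p :: rem))) &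
   [/\ (forall y, y < n -> nth false a y -> tau' y = t -> nth false N y), tau' x = t & pi' x = p]].
  case: cmp => [exy|Dxy]; first by exists tau, pi; rewrite exy.
  have nxy : x != y by apply/eqP => e'; move: Dxy; rewrite e' (negbTE (Dirr _)).
  have remx u : u \in p :: rem -> u != x /\ u != y.
    move=> /remP[_ tu]; split; apply/eqP => e; move: tu; rewrite e ?ty; lia.
  exists (fun z => tau (transp x y z)), (fun z => regraft tau pi x y (transp x y z)).
  have hy : regraft tau pi x y y = p.
    by rewrite /regraft ey; case: eqP => // e; move: tp; rewrite e ty ltnn.
  (* Since [y] itself loses in round [t], it beats nobody in that round, so the exchange leaves the
     victors of round [t] alone. *)
  have hE w : w < n -> tau w = t -> regraft tau pi x y w = pi w.
    move=> ltw tw; rewrite /regraft; case: eqP => // e.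
    by have [_] := s_par so ltw (tau_root so tw); rewrite e ty tw ltnn.
  split.
  - by apply: sol_exchange => //; rewrite ?ty ?ey.
  - apply: agree_eq ag _ => w ltw aw.
    have nwx : w != x by apply: contraNneq Ux => <-.
    have nwy : w != y by apply: contraNneq Uy => <-.
    rewrite transp_fix //; split=> //; rewrite /regraft.
    by case: eqP => [->|_] /=; [case: ifP => _; [right; rewrite Uy | left] | left].
  - by move=> u ur; have [nux nuy] := remx u ur; rewrite transp_fix //; apply: remP.
  - move=> w ltw; case: (eqVneq w x) => [->|nwx].
      by rewrite (negbTE Nx) transpL ty ltnn eqxx hy mem_head.
    case: (eqVneq w y) => [->|nwy].
      rewrite (negbTE Ny) transpR ltnNge tx /=; case: eqP => // ex.
      by rewrite hE //; move: Nx; rewrite NE // ex ltnn eqxx /= negbK => ->.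
    rewrite transp_fix // NE //; case: (ltngtP (tau w) t) => //= tw.
    by rewrite hE.
  - rewrite transpL; split=> // w ltw aw.
    have nwx : w != x by apply: contraNneq Ux => <-.
    have nwy : w != y by apply: contraNneq Uy => <-.
    by rewrite transp_fix //; apply: NA.
exists tau', pi'; split=> //=.
- by rewrite okT ltx Nx Dpx.
- by move=> u ur; apply: remP'; rewrite inE ur orbT.
- move=> w ltw; rewrite nth_addm // NE' //; case: (ltngtP (tau' w) t) => //= tw.
    by apply/eqP => e; move: tw; rewrite e tx' ltnn.
  rewrite inE negb_or; case: (eqVneq (pi' w) p) => [e|ne] /=.
    rewrite e nprem; apply/eqP; apply: (s_inj so') => //; rewrite ?tx' ?px' //; exact: tau_root so' _.
  by case: (eqVneq w x) => [e|_]; rewrite ?orbF //; move: ne; rewrite e px' eqxx.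
- by move=> w ltw aw tw; rewrite nth_addm // NA'.
Qed.

Lemma inv2_fold rem st : uniq rem -> inv2 rem st -> inv2 [::] (foldl (phase2 n D a) st rem).
Proof.
elim: rem st => //= p rem IH st ur iv; apply: IH; first by case/andP: ur.
exact: inv2_step.
Qed.

Lemma inv1_fold st : inv1 0 st -> inv1 m (foldl (phase1 n D a al g t) st (iota 0 m)).
Proof.
move=> iv; have: m <= m by []; elim: {1 3 4}m => [|i IH] // lti.
rewrite -[i.+1]addn1 iotaD foldl_cat /= add0n addn1.
by apply: inv1_step => //; apply: IH; apply: ltnW.
Qed.
End Round.

Definition inv g t (st : seq bool * bool) := exists tau pi,
  [/\ sol tau pi, agree g tau pi, st.2 &
   forall y, y < n -> nth false st.1 y = (tau y < t.+1)].

Lemma inv_round g st t : t < k -> inv g t st -> inv g t.+1 (round n D a al g st t).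
Proof.
case: st => [alive ok] ltk [tau [pi [so ag /= okT aE]]].
have : inv1 g t.+1 0 (alive, alive, ok).
  exists tau, pi; split=> //=.
  - by move=> p ltp; rewrite aE.
  - move=> y lty; rewrite aE //; case: eqP => [ty|_]; rewrite ?orbF //=.
    have nyv := tau_root (isT : 0 < t.+1) so ty; have [ltp tp _ _] := s_par so lty nyv.
    by rewrite aE // -ty tp orbF.
  - move=> j ltj ej; have [ltx _] := al_lt ltj; have [et _] := ag j ltj.
    by rewrite aE // et ej ltnn.
move/(inv1_fold (isT : 0 < t.+1) ltk); rewrite /round -/m /=.
case: (foldl _ _ _) => [[P N] ok1] [tau1 [pi1 [[so1 ag1] /= okT1 Pt NE NA]]].
have : inv2 g t.+1 (elems n P) (N, ok1).
  exists tau1, pi1; split=> //=.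
  - by move=> p; rewrite mem_elems => /andP[ltp Pp]; split=> //; apply: Pt.
  - move=> y lty; rewrite NE //; case: eqP => //= ty; congr (_ || _).
    have nyv := tau_root (isT : 0 < t.+1) so1 ty; have [ltp tp _ _] := s_par so1 lty nyv.
    by rewrite mem_elems ltp.
  - move=> y lty ay ty; have [j ltj ej] := al_nth lty ay.
    by rewrite -ej NA // -?ej; have [<- _] := ag1 j ltj; rewrite ej.
move/(inv2_fold (isT : 0 < t.+1) ltk (uniq_elems _ _)).
case: (foldl _ _ _) => [N2 ok2] [tau2 [pi2 [[so2 ag2] /= okT2 _ NE2 _]]].
by exists tau2, pi2; split=> // y lty; rewrite NE2 // ?in_nil andbT [RHS]ltnS [RHS]leq_eqVlt orbC.
Qed.

(** The guess is read off the solution. A round is at most [k] and a position in [al] at most [m],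
    where [m] stands for an unaffected victor; hence the base [k + m + 1]. *)
Lemma check_complete start tau pi : sol tau pi ->
  (forall y, y < n -> nth false start y = (y == v)) ->
  exists g, [/\ size g = m + m, all (fun d => d < k + m + 1) g & check n D a al start k g].
Proof.
move=> so startE; pose g := [seq tau x | x <- al] ++ [seq index (pi x) al | x <- al].
have tk x : x < n -> tau x <= k.
  by case: (eqVneq x v) => [->|nv ltx]; [rewrite (s_root so) | case: (s_par so ltx nv)].
exists g; split; first by rewrite size_cat !size_map.
  rewrite all_cat !all_map; apply/andP; split; apply/allP => x /=.
    by rewrite mem_elems => /andP[/tk]; lia.
  by move=> _; have := index_size (pi x) al; rewrite -/m; lia.
have ag : agree g tau pi.
  move=> i lti.
  have -> : nth 0 g i = tau (nth n al i) by rewrite /g nth_cat size_map -/m lti (nth_map n).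
  have -> : nth 0 g (m + i) = index (pi (nth n al i)) al.
    by rewrite /g nth_cat size_map -/m ltnNge leq_addr /= addKn (nth_map n).
  split=> // nv; have [ltx ax] := al_lt lti.
  have [ltp _ _ _] := s_par so ltx nv.
  case: (boolP (pi (nth n al i) \in al)) => [pa|npa]; first by rewrite nth_index // ltp.
  rewrite memNindex // nth_default // ltnn.
  by apply: contra npa => ap; rewrite mem_elems ltp.
rewrite /check.
have inv0 : inv g 0 (start, true).
  exists tau, pi; split=> //= y lty; rewrite startE //.
  case: (eqVneq y v) => [->|nv]; first by rewrite (s_root so).
  by have [_ + _ _] := s_par so lty nv; case: (tau y).
have: k <= k by []; suff: forall i, i <= k -> inv g i (foldl (round n D a al g) (start, true) (iota 0 i)).
  by move=> h /h[? [? []]].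
elim=> [|i IH] // lti; rewrite -[in iota _ _]addn1 iotaD foldl_cat /= add0n.
by apply: inv_round => //; apply: IH; apply: ltnW.
Qed.
End Completeness.

(** * From a winning seeding to rounds and victors *)

Lemma mem_ko_round (T : eqType) (D : rel T) (s : seq T) : {subset ko_round D s <= s}.
Proof.
move: {2}(size s) (leqnn (size s)) => j; elim: j s => [|j IH] [|x [|y s]] les z //=.
rewrite !inE => /orP[/eqP ->|zs]; first by case: ifP; rewrite eqxx ?orbT.
by rewrite (IH s) ?orbT // ltnW.
Qed.

Lemma ko_pairs (T : eqType) (D : rel T) (s : seq T) j :
  (forall x y, x \in s -> y \in s -> x != y -> D x y = ~~ D y x) -> uniq s -> size s = j + j ->
  exists L, [/\ unzip1 L = ko_round D s, perm_eq s (unzip1 L ++ unzip2 L) &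
                 all (fun p => D p.1 p.2) L].
Proof.
elim: j s => [|j IH] s; first by case: s => // _ _ _; exists [::].
rewrite addSn addnS; case: s => [|x [|y s]] // Dt /= /andP[nx /andP[ny us]] [ss].
have [|//|//|L [e1 p1 aL]] := IH s.
  by move=> u w us' ws; apply: Dt; rewrite !inE ?us' ?ws !orbT.
move: nx; rewrite inE negb_or => /andP[nxy nx].
exists ((if D x y then (x, y) else (y, x)) :: L); split=> /=.
- by rewrite e1; case: ifP.
- apply/permP => q; have /permP/(_ q) := p1; rewrite /= !count_cat /=.
  by case: ifP => _ /=; lia.
- rewrite aL andbT; case: ifP => //= nD.
  by rewrite Dt ?nD ?inE ?eqxx ?orbT // eq_sym.
Qed.

(** Counted from the final, the rounds of the survivors do not change when a round is put in front.
    So the first-round losers get [k.+1] and the rest comes from the induction hypothesis. *)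
Lemma seeding_brackets (T : eqType) (x0 : T) (D : rel T) k (s : seq T) v :
  (forall x y, x \in s -> y \in s -> x != y -> D x y = ~~ D y x) -> uniq s -> size s = 2 ^ k ->
  iter k (ko_round D) s = [:: v] ->
  exists (tau : T -> nat) (pi : T -> T), [/\ tau v = 0,
    forall y, y \in s -> y != v -> [/\ pi y \in s, tau (pi y) < tau y, tau y <= k & D (pi y) y],
    forall y z, y \in s -> z \in s -> y != v -> z != v -> pi y = pi z -> tau y = tau z -> y = z &
    forall x t, x \in s -> tau x < t -> t <= k ->
      exists y, [/\ y \in s, y != v, pi y = x & tau y = t]].
Proof.
elim: k s => [|k IH] s Dt us ss its.
  move: its => /= ->; exists (fun=> 0), id; split=> //.
  - by move=> y; rewrite inE => /eqP -> /eqP.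
  - by move=> x t _; case: t.
have [|L [e1 p1 aL]] := ko_pairs Dt us (j := 2 ^ k); first by rewrite ss expnS mul2n addnn.
set s1 := ko_round D s in e1; rewrite iterSr -/s1 in its.
have uL : uniq (unzip1 L ++ unzip2 L) by rewrite -(perm_uniq p1).
have [us1 disj u2] : [/\ uniq s1, (forall x, x \in s1 -> x \notin unzip2 L) & uniq (unzip2 L)].
  move: uL; rewrite cat_uniq e1 => /and3P[? /hasPn h ?]; split=> // x xs.
  by apply/negP => /h /=; rewrite xs.
have ss1 : size s1 = 2 ^ k.
  have := perm_size p1; rewrite size_cat ss expnS -e1 !size_map; lia.
have ms x : (x \in s) = (x \in s1) || (x \in unzip2 L) by rewrite (perm_mem p1) mem_cat e1.
have [|tau [pi [root par inj ex]]] := IH s1 _ us1 ss1 its.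
  by move=> x y xs ys; apply: Dt; rewrite ms ?xs ?ys.
have vs1 : v \in s1.
  have sub i : {subset iter i (ko_round D) s1 <= s1}.
    by elim: i => //= i IHi x /mem_ko_round/IHi.
  by apply: (sub k); rewrite its mem_head.
(* Winners and losers of the first round are listed in parallel. *)
pose op y := nth x0 s1 (index y (unzip2 L)).
have sL : size (unzip2 L) = size s1 by rewrite -e1 !size_map.
have opP y : y \in unzip2 L -> op y \in s1 /\ D (op y) y.
  move=> yL; have lt : index y (unzip2 L) < size L by rewrite -(size_map snd) index_mem.
  split; first by rewrite mem_nth // -sL index_mem.
  have e : (nth (x0, x0) L (index y (unzip2 L))).2 = y.
    by rewrite -(nth_map (x0, x0) x0 snd) // nth_index.
  have := all_nthP (x0, x0) aL _ lt; rewrite e.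
  by rewrite /op -e1 (nth_map (x0, x0)).
exists (fun y => if y \in s1 then tau y else k.+1), (fun y => if y \in s1 then pi y else op y).
split.
- by rewrite vs1.
- move=> y; rewrite ms => /orP[ys|yL] nv.
    by have [p1' p2' p3' p4'] := par y ys nv; rewrite ys p1' ms p1'; split=> //; apply: leqW.
  have ny : y \notin s1 by apply/negP => /disj; rewrite yL.
  have [o1 o2] := opP y yL; rewrite (negbTE ny) o1 ms o1; split=> //.
  case: (eqVneq (op y) v) => [->|nov]; first by rewrite root.
  by have [_ _ + _] := par _ o1 nov; rewrite ltnS.
- have tk y : y \in s1 -> tau y < k.+1.
    by case: (eqVneq y v) => [->|nv ys]; [rewrite root | have [] := par y ys nv].
  move=> y z; rewrite !ms => /orP[ys|yL] /orP[zs|zL] nyv nzv.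
  + by rewrite ys zs; apply: inj.
  + have nz : z \notin s1 by apply/negP => /disj; rewrite zL.
    by rewrite ys (negbTE nz) => _ e; have := tk y ys; rewrite e ltnn.
  + have ny : y \notin s1 by apply/negP => /disj; rewrite yL.
    by rewrite zs (negbTE ny) => _ e; have := tk z zs; rewrite -e ltnn.
  + have nz : z \notin s1 by apply/negP => /disj; rewrite zL.
    have ny : y \notin s1 by apply/negP => /disj; rewrite yL.
    rewrite (negbTE ny) (negbTE nz) => /eqP; rewrite /op nth_uniq // -?sL ?index_mem // => /eqP e _.
    by rewrite -(nth_index x0 yL) e nth_index.
- move=> x t; rewrite ms => /orP[xs|xL].
    rewrite xs => tx; rewrite leq_eqVlt => /predU1P[->|tk].
      have lt : index x s1 < size (unzip2 L) by rewrite sL index_mem.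
      have yL := mem_nth x0 lt; exists (nth x0 (unzip2 L) (index x s1)).
      have ny : nth x0 (unzip2 L) (index x s1) \notin s1 by apply/negP => /disj; rewrite yL.
      rewrite ms yL orbT (negbTE ny) /op index_uniq // nth_index //; split=> //.
      by apply: contraNneq ny => ->.
    have [y [ys nyv ey ty]] := ex x t xs tx tk.
    by exists y; rewrite ms ys.
  have nx : x \notin s1 by apply/negP => /disj; rewrite xL.
  by rewrite (negbTE nx); lia.
Qed.

(** * Affected vertices and enumeration of the guesses *)

Lemma foldl_inv (S I : Type) (P : S -> Prop) (f : S -> I -> S) s l :
  P s -> (forall s i, P s -> P (f s i)) -> P (foldl f s l).
Proof. by move=> + fP; elim: l s => //= i l IH s /fP-/(_ i)/IH. Qed.

Lemma foldl_inv_in (S : Type) (I : eqType) (P : S -> Prop) (f : S -> I -> S) s l :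
  P s -> (forall s i, i \in l -> P s -> P (f s i)) -> P (foldl f s l).
Proof.
elim: l s => //= i l IH s Ps fP; apply: IH; first by apply: fP; rewrite ?mem_head.
by move=> s' j jl; apply: fP; rewrite inE jl orbT.
Qed.

Lemma foldl_hit (S : Type) (I : eqType) (P : S -> Prop) (f : S -> I -> S) s l i :
  i \in l -> (forall s, P (f s i)) -> (forall s j, P s -> P (f s j)) -> P (foldl f s l).
Proof.
move=> + hit pres; elim: l s => //= j l IH s; rewrite inE => /predU1P[<-|il].
  by apply: (foldl_inv (P := P)).
exact: IH.
Qed.

Lemma count_leq (T : eqType) (p q : pred T) l :
  (forall y, y \in l -> p y -> q y) -> count p l <= count q l.
Proof.
elim: l => //= y l IH pq; apply: leq_add.
  by have := pq y (mem_head _ _); case: (p y) => // ->.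
by apply: IH => z zl; apply: pq; rewrite inE zl orbT.
Qed.

Lemma count_ltn (T : eqType) (p q : pred T) l x :
  (forall y, y \in l -> p y -> q y) -> x \in l -> ~~ p x -> q x -> count p l < count q l.
Proof.
move=> pq xl npx qx; have pr := permP (perm_to_rem xl); rewrite !pr /= (negbTE npx) qx ltnS.
by apply: count_leq => y /mem_rem; apply: pq.
Qed.

Section Affected.
Variables (n : nat) (D : rel nat).

(** When the triangle is visited, it is either added or already has two vertices in the mask. In
    both cases [x] or [y] is in it from then on, as masks only grow. *)
Lemma affected_noTri x y z : x < n -> y < n -> z < n ->
  ~~ nth false (affected n D) x -> ~~ nth false (affected n D) y ->
  D x y -> D y z -> ~~ D z x.
Proof.
move=> ltx lty ltz Ux Uy Dxy Dyz; apply/negP => Dzx.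
pose P (a : seq bool) := nth false a x || nth false a y.
have pres a u v w : P a -> P (aff_step n D a u v w).
  rewrite /P /aff_step; case: ifP => // _ h.
  by rewrite !nth_addm //; case/orP: h => ->; rewrite ?orbT.
suff : P (affected n D) by rewrite /P (negbTE Ux) (negbTE Uy).
rewrite /affected; apply: (@foldl_hit _ _ P _ _ _ x) => [|a|a j Pa]; first by rewrite mem_iota.
  apply: (@foldl_hit _ _ P _ _ _ y) => [|{}a|{}a j Pa]; first by rewrite mem_iota.
    apply: (@foldl_hit _ _ P _ _ _ z) => [|{}a|{}a j Pa]; first by rewrite mem_iota.
      rewrite /P /aff_step Dxy Dyz Dzx /=; case: ifP => [_|]; first by rewrite !nth_addm // eqxx ?orbT.
      by case: (nth false a x); case: (nth false a y).
    exact: pres.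
  by apply: (foldl_inv (P := P)) => // {Pa}a i; apply: pres.
apply: (foldl_inv (P := P)) => // {Pa}a i Pa.
by apply: (foldl_inv (P := P)) => // {Pa}a i'; apply: pres.
Qed.

Lemma size_elems_addm a x : size (elems n (addm n a x)) <= (size (elems n a)).+1.
Proof.
case: (ltnP x n) => [ltx|lex]; last first.
  suff -> : elems n (addm n a x) = elems n a by [].
  apply: eq_in_filter => y; rewrite mem_iota /= add0n => lty; rewrite nth_addm //.
  by case: eqP => [e|]; [move: lty; rewrite e ltnNge lex | rewrite orbF].
case: (boolP (nth false a x)) => ax; last by rewrite (perm_size (perm_elems_add ltx ax)).
suff -> : elems n (addm n a x) = elems n a by [].
apply: eq_in_filter => y; rewrite mem_iota /= add0n => lty; rewrite nth_addm //.
by case: eqP => [->|]; rewrite ?ax ?orbF.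
Qed.

(** The potential is the number of arcs of [F] with both ends in the mask. A triangle that is added
    had at most one vertex inside, so its arc in [F] is newly counted, while the mask gains at most
    three players. *)
Lemma size_affected (F : seq (nat * nat)) :
  (forall e, e \in F -> e.1 < n /\ e.2 < n) ->
  (forall x y z, x < n -> y < n -> z < n -> D x y -> D y z -> D z x ->
     [\/ (x, y) \in F, (y, z) \in F | (z, x) \in F]) ->
  size (elems n (affected n D)) <= 3 * size F.
Proof.
move=> Flt hit; pose c (a : seq bool) (e : nat * nat) := nth false a e.1 && nth false a e.2.
pose P a := size (elems n a) <= 3 * count (c a) F.
suff : P (affected n D) by move=> h; apply: leq_trans h _; rewrite leq_mul2l count_size.
have pres a x y z : x < n -> y < n -> z < n -> P a -> P (aff_step n D a x y z).
  move=> ltx lty ltz; rewrite /aff_step; case: ifP => // /and5P[Dxy Dyz Dzx nxy /andP[nyz nxz]] Pa.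
  set a' := addm n _ z.
  have a'E u : u < n -> nth false a' u = [|| nth false a u, u == x, u == y | u == z].
    by move=> ltu; rewrite !nth_addm // -!orbA.
  suff lt : count (c a) F < count (c a') F.
    have := size_elems_addm a x; have := size_elems_addm (addm n a x) y.
    have := size_elems_addm (addm n (addm n a x) y) z; rewrite -/a'.
    by move: Pa lt; rewrite /P; lia.
  have mono e : e \in F -> c a e -> c a' e.
    by move=> /Flt[l1 l2] /andP[h1 h2]; rewrite /c !a'E // h1 h2.
  have [h|h|h] := hit x y z ltx lty ltz Dxy Dyz Dzx; apply: (count_ltn mono h);
    rewrite /c //= ?a'E // ?eqxx ?orbT //.
  by rewrite andbC.
rewrite /affected.
have P0 : P [::] by rewrite /P /elems (eq_filter (a2 := pred0)) ?filter_pred0 // => x; rewrite nth_nil.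
apply: (foldl_inv_in (P := P)) P0 _ => a x; rewrite mem_iota /= add0n => ltx Pa.
apply: (foldl_inv_in (P := P)) Pa _ => {}a y; rewrite mem_iota /= add0n => lty Pa.
apply: (foldl_inv_in (P := P)) Pa _ => {}a z; rewrite mem_iota /= add0n => ltz Pa.
exact: pres.
Qed.
End Affected.

(* Little-endian increment in base [B]; the flag signals an overflow. *)
Fixpoint incr (B : nat) (l : seq nat) : bool * seq nat :=
  if l is d :: l' then
    if d.+1 < B then (false, d.+1 :: l') else ((incr B l').1, 0 :: (incr B l').2)
  else (true, [::]).

Fixpoint value (B : nat) (l : seq nat) : nat := if l is d :: l' then d + B * value B l' else 0.

Section Odometer.
Variable B : nat.
Hypothesis B0 : 0 < B.
Implicit Types l : seq nat.

Lemma value_lt l : all (fun d => d < B) l -> value B l < B ^ size l.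
Proof. by elim: l => //= d l IH /andP[ltd /IH]; rewrite expnS; nia. Qed.

Lemma value_inj l l' : all (fun d => d < B) l -> all (fun d => d < B) l' ->
  size l = size l' -> value B l = value B l' -> l = l'.
Proof.
elim: l l' => [|d l IH] [|d' l'] //= /andP[ltd al] /andP[ltd' al'] [ss] e.
have ed : d = d'.
  by have := congr1 (modn^~ B) e; rewrite ![B * _]mulnC ![_ + _ * B]addnC !modnMDl !modn_small.
congr (_ :: _) => //; apply: IH => //; move: e; rewrite ed => /addnI/eqP.
by rewrite eqn_pmul2l // => /eqP.
Qed.

Lemma incr_all l : all (fun d => d < B) l -> all (fun d => d < B) (incr B l).2.
Proof.
by elim: l => //= d l IH /andP[ltd al]; case: ifP => [lt|_] /=; rewrite ?lt ?al ?B0 ?IH.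
Qed.

Lemma incr_size l : size (incr B l).2 = size l.
Proof. by elim: l => //= d l IH; case: ifP => //= _; rewrite IH. Qed.

Lemma incr_value l : all (fun d => d < B) l ->
  (incr B l).1 = ((value B l).+1 == B ^ size l) /\
  (~~ (incr B l).1 -> value B (incr B l).2 = (value B l).+1).
Proof.
elim: l => [|d l IH] //= /andP[ltd al]; have [IH1 IH2] := IH al; have lt := value_lt al.
case: ifP => [ltB|/negbT] /=.
  by split=> //; apply/esym/eqP; rewrite expnS; nia.
rewrite -leqNgt => leB; have ed : d = B.-1 by lia.
split.
  rewrite IH1 expnS ed -addSn prednK // -mulnS; apply/esym.
  by rewrite eqn_pmul2l.
by move=> /IH2 ->; rewrite ed -addSn prednK // -mulnS.
Qed.

Definition guess m i := iter i (fun g => (incr B g).2) (nseq m 0).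

Lemma guess_all m i : all (fun d => d < B) (guess m i).
Proof. by elim: i => [|i IH] /=; [rewrite all_nseq B0 orbT | apply: incr_all]. Qed.
Lemma guess_size m i : size (guess m i) = m.
Proof. by elim: i => [|i IH] /=; rewrite ?size_nseq // incr_size. Qed.

Lemma guess_value m i : i < B ^ m -> value B (guess m i) = i.
Proof.
elim: i => [_|i IH lti]; first by rewrite /guess /=; elim: m => //= m ->; rewrite muln0.
have [e1 e2] := incr_value (guess_all m i).
have ei : value B (guess m i) = i by apply: IH; apply: ltnW.
rewrite ei guess_size in e1 e2; rewrite -[guess m i.+1]/((incr B (guess m i)).2).
by apply: e2; rewrite e1 neq_ltn lti.
Qed.

Lemma guess_overflow m i : i < B ^ m -> (incr B (guess m i)).1 = (i.+1 == B ^ m).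
Proof. by move=> lti; have [-> _] := incr_value (guess_all m i); rewrite guess_value // guess_size. Qed.

Lemma guess_surj m g : size g = m -> all (fun d => d < B) g ->
  exists2 i, i < B ^ m & guess m i = g.
Proof.
move=> sg ag; exists (value B g); first by rewrite -sg value_lt.
apply: value_inj => //; rewrite ?guess_all ?guess_size // guess_value //.
by rewrite -sg value_lt.
Qed.
End Odometer.

(* An instance with [n] players is encoded by [n + n * n] bits. *)
Definition find_n (w : seq bool) :=
  foldl (fun b i => if i + i * i == size w then i else b) 0 (iota 0 (size w).+1).

Lemma find_nE w n : size w = n + n * n -> find_n w = n.
Proof.
move=> sw; rewrite /find_n sw.
have e i : (i + i * i == n + n * n) = (i == n) by apply/eqP/eqP => [|->//]; nia.
suff inv j : foldl (fun b i => if i + i * i == n + n * n then i else b) 0 (iota 0 j) =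
    if n < j then n else 0 by rewrite inv ltnS leq_addr.
elim: j => // j IH; rewrite -[j.+1]addn1 iotaD foldl_cat IH /= add0n e addn1 ltnS [in RHS]leq_eqVlt.
by rewrite [n == j]eq_sym; case: eqP => [->|].
Qed.

Definition log_step (n : nat) (st : nat * nat) (_ : nat) :=
  if st.2 < n then (st.1.+1, st.2 + st.2) else st.
Definition find_k (n : nat) := (foldl (log_step n) (0, 1) (iota 0 n)).1.

Lemma find_kE k : find_k (2 ^ k) = k.
Proof.
rewrite /find_k.
have inv i : foldl (log_step (2 ^ k)) (0, 1) (iota 0 i) = (minn i k, 2 ^ minn i k).
  elim: i => [|i IH]; first by rewrite min0n.
  rewrite -[in iota _ _]addn1 iotaD foldl_cat IH /= /log_step /= ltn_exp2l //.
  case: (ltnP i k) => [lt|le].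
    have -> : minn i.+1 k = i.+1 by lia.
    by rewrite lt addnn -mul2n -expnS.
  have -> : minn i.+1 k = k by lia.
  by rewrite ltnn.
rewrite inv /=; apply/minn_idPr; apply: ltnW; exact: ltn_expl.
Qed.

(** * The algorithm runs in polynomial time *)

Definition beats (w : seq bool) (n : nat) : rel nat := fun x y => nth false w (n + x * n + y).

Lemma esz_mask (l : seq bool) : esz l <= 4 * size l + 1.
Proof. by elim: l => //= b l IH; rewrite esz_cons; have := esz_bool b; lia. Qed.

Lemma PB_size_nat E `{encodable E} (f : E -> nat) : PT f -> PB f.
Proof. by move=> fP; apply: PB_le (PT_size fP) => e; rewrite esz_nat -addnn; lia. Qed.

Lemma esz_addm n a x : esz (addm n a x) <= 4 * n + 1.
Proof. by apply: leq_trans (esz_mask _) _; rewrite size_map size_iota. Qed.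
Lemma esz_delm n a x : esz (delm n a x) <= 4 * n + 1.
Proof. by apply: leq_trans (esz_mask _) _; rewrite size_map size_iota. Qed.

Lemma PT_find_n : PT find_n.
Proof. by rewrite /find_n; pt. Qed.

Lemma PT_find_k : PT find_k.
Proof.
rewrite /find_k; apply: PT_fst.
apply: (@PT_foldl _ _ _ _ _ _ (fun n => iota 0 n) (fun=> (0, 1)) log_step (fun p => p.1 * 2 + 4)).
- by pt.
- by pt.
- by rewrite /log_step; pt.
- by apply: PB_add; [apply: PB_mul; [apply: PB_size_nat; pt | apply: PB_const] | apply: PB_const].
- move=> n [c p] i; rewrite /log_step /=; case: ifP => lt; rewrite ?esz_pair ?esz_nat -?addnn; lia.
Qed.

Lemma esz_aff_step n D a x y z : esz (aff_step n D a x y z) <= maxn (esz a) (4 * n + 1).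
Proof. by rewrite /aff_step; case: ifP => _; rewrite leq_max ?esz_addm ?leqnn ?orbT. Qed.

(** For inner loops: masks are rebuilt rather than extended, so a maximum bounds the whole loop by
    the same quantity as one step. *)
Lemma esz_foldl_max (B I : Type) `{encodable B} (f : B -> I -> B) b l m :
  (forall b i, esz (f b i) <= maxn (esz b) m) -> esz (foldl f b l) <= maxn (esz b) m.
Proof.
move=> fP; apply: (foldl_inv (P := fun b' => esz b' <= maxn (esz b) m)) => [|b' i le].
  exact: leq_maxl.
by apply: leq_trans (fP _ _) _; rewrite geq_max le leq_maxr.
Qed.

Lemma PB_mask E A `{encodable E} `{encodable A} (f : E -> nat) :
  PT f -> PB (fun p : E * A => 4 * f p.1 + 1).
Proof.
move=> fP; apply: PB_add; last exact: PB_const.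
apply: PB_mul; first exact: PB_const.
by apply: PB_size_nat; apply: (PT_comp fP); pt.
Qed.

Lemma PT_affected : PT (fun e : seq bool * nat => affected e.2 (beats e.1 e.2)).
Proof.
rewrite /affected.
apply: (@PT_foldl _ _ _ _ _ _ _ _ (fun e a x => foldl (fun a y => foldl (fun a z =>
   aff_step e.2 (beats e.1 e.2) a x y z) a (iota 0 e.2)) a (iota 0 e.2)) (fun p => 4 * p.1.2 + 1)).
- by pt.
- by pt.
- apply: (@PT_foldl _ _ _ _ _ _ _ _ (fun e a y => foldl (fun a z =>
   aff_step e.1.1.2 (beats e.1.1.1 e.1.1.2) a e.2 y z) a (iota 0 e.1.1.2)) (fun p => 4 * p.1.1.1.2 + 1)).
  + by pt.
  + by pt.
  + apply: (@PT_foldl _ _ _ _ _ _ _ _ (fun e a z =>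
      aff_step e.1.1.1.1.2 (beats e.1.1.1.1.1 e.1.1.1.1.2) a e.1.1.2 e.2 z) (fun p => 4 * p.1.1.1.1.1.2 + 1)).
    * by pt.
    * by pt.
    * by rewrite /aff_step /addm /beats; pt.
    * by apply: (@PB_mask _ _ _ _ (fun e => e.1.1.1.1.2)); pt.
    * by move=> e b a; have := esz_aff_step e.1.1.1.1.2 (beats e.1.1.1.1.1 e.1.1.1.1.2) b e.1.1.2 e.2 a;
        rewrite /=; lia.
  + by apply: (@PB_mask _ _ _ _ (fun e => e.1.1.2)); pt.
  + move=> e b a; apply: leq_trans (esz_foldl_max (m := 4 * e.1.1.2 + 1) _ _ _) _; last by rewrite /=; lia.
    by move=> b' i; apply: esz_aff_step.
- by apply: (@PB_mask _ _ _ _ (fun e => e.2)); pt.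
- move=> e b a; apply: leq_trans (esz_foldl_max (m := 4 * e.2 + 1) _ _ _) _; last by rewrite /=; lia.
  move=> b' i; apply: esz_foldl_max => b2 j; exact: esz_aff_step.
Qed.

Notation env := (seq bool * nat * seq bool * seq nat * nat * nat)%type.
Definition e_w (e : env) := e.1.1.1.1.1.
Definition e_n (e : env) := e.1.1.1.1.2.
Definition e_a (e : env) := e.1.1.1.2.
Definition e_al (e : env) := e.1.1.2.
Definition e_k (e : env) := e.1.2.
Definition e_B (e : env) := e.2.
Definition e_D (e : env) := beats (e_w e) (e_n e).

Ltac unenv := rewrite /e_D /e_w /e_n /e_a /e_al /e_k /e_B.

Lemma esz_phase1 n D a al g t st i : esz (phase1 n D a al g t st i) <= maxn (esz st) (8 * n + 7).
Proof.
rewrite /phase1; case: ifP => _; last exact: leq_maxl.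
rewrite leq_max; apply/orP; right; rewrite /assign !esz_pair.
set p := (X in delm _ _ X); set x := (X in addm _ _ X); set b := [&& _, _, _, _ & _].
by have := esz_delm n st.1.1 p; have := esz_addm n st.1.2 x; have := esz_bool b; lia.
Qed.

Lemma PT_phase1_fold : PT (fun p : env * seq nat * (seq bool * bool) * nat =>
  foldl (phase1 (e_n p.1.1.1) (e_D p.1.1.1) (e_a p.1.1.1) (e_al p.1.1.1) p.1.1.2 p.2.+1)
    (p.1.2.1, p.1.2.1, p.1.2.2) (iota 0 (size (e_al p.1.1.1)))).
Proof.
apply: (@PT_foldl _ _ _ _ _ _ _ _ (fun p => phase1 (e_n p.1.1.1) (e_D p.1.1.1) (e_a p.1.1.1)
   (e_al p.1.1.1) p.1.1.2 p.2.+1) (fun q => 8 * e_n q.1.1.1.1 + 7)).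
- by unenv; pt.
- by unenv; pt.
- by rewrite /phase1 /assign /weakest_parent /best /addm /delm; unenv; rewrite /beats; pt.
- by unenv; apply: PB_add; [apply: PB_mul; [apply: PB_const | apply: PB_size_nat; pt] | apply: PB_const].
- by move=> e b i; apply: leq_trans (esz_phase1 _ _ _ _ _ _ _ _) _; rewrite /=; lia.
Qed.

Lemma esz_phase2 n D a st p : esz (phase2 n D a st p) <= maxn (esz st) (4 * n + 5).
Proof.
rewrite leq_max; apply/orP; right; rewrite /phase2 !esz_pair.
set x := strongest_child _ _ _ _ _; set b := [&& _, _, _ & _].
by have := esz_addm n st.1 x; have := esz_bool b; lia.
Qed.

Lemma esz_round n D a al g st t : esz (round n D a al g st t) <= esz st + (12 * n + 20).
Proof.
rewrite /round; set s1 := foldl (phase1 _ _ _ _ _ _) _ _.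
apply: leq_trans (esz_foldl_max (m := 4 * n + 5) _ _ _) _.
  by move=> b i; apply: esz_phase2.
have : esz s1.1.2 <= maxn (esz st) (4 * n + 1).
  apply: (foldl_inv (P := fun s => esz s.1.2 <= maxn (esz st) (4 * n + 1))) => [|s i le].
    by case: (st) => [x y] /=; rewrite esz_pair; lia.
  rewrite /phase1; case: ifP => // _ /=.
  by rewrite leq_max esz_addm orbT.
by rewrite esz_pair; have := esz_bool s1.2; lia.
Qed.

Lemma PT_round : PT (fun p : env * seq nat * (seq bool * bool) * nat =>
  round (e_n p.1.1.1) (e_D p.1.1.1) (e_a p.1.1.1) (e_al p.1.1.1) p.1.1.2 p.1.2 p.2).
Proof.
have P1 := PT_phase1_fold; rewrite /round.
apply: (@PT_foldl _ _ _ _ _ _ _ _ (fun p => phase2 (e_n p.1.1.1) (e_D p.1.1.1) (e_a p.1.1.1))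
   (fun q => 4 * e_n q.1.1.1.1 + 5)).
- rewrite /elems; apply: PT_filter; first by unenv; pt.
  apply: PT_nth; [by pt | | by pt].
  do 2 apply: PT_fst; apply: (PT_comp P1); pt.
- by apply: PT_pair; [apply: PT_snd; apply: PT_fst | apply: PT_snd].
- by rewrite /phase2 /strongest_child /best /addm; unenv; rewrite /beats; pt.
- by unenv; apply: PB_add; [apply: PB_mul; [apply: PB_const | apply: PB_size_nat; pt] | apply: PB_const].
- by move=> e b i; apply: leq_trans (esz_phase2 _ _ _ _ _) _; rewrite /=; lia.
Qed.

(* The first [n] bits of the input mark the player [v], so that the input itself serves
   as the mask of the players alive in the final. *)
Definition env_check (e : env) (g : seq nat) :=
  check (e_n e) (e_D e) (e_a e) (e_al e) (e_w e) (e_k e) g.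

Lemma PT_check : PT (fun p : env * seq nat => env_check p.1 p.2).
Proof.
rewrite /env_check /check; apply: PT_snd.
apply: (@PT_foldl _ _ _ _ _ _ _ _ (fun p => round (e_n p.1) (e_D p.1) (e_a p.1) (e_al p.1) p.2)
   (fun q => 12 * e_n q.1.1 + 20)).
- by unenv; pt.
- by unenv; pt.
- exact: PT_round.
- by unenv; apply: PB_add; [apply: PB_mul; [apply: PB_const | apply: PB_size_nat; pt] | apply: PB_const].
- by move=> e b i; apply: esz_round.
Qed.

(** [incr] as a left fold: the flag is the pending carry, and the digits come out in reverse
    order. *)
Definition incr_step (B : nat) (st : bool * seq nat) (d : nat) :=
  if st.1 then if d.+1 < B then (false, d.+1 :: st.2) else (true, 0 :: st.2)
  else (false, d :: st.2).

Lemma incr_foldl B l acc :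
  foldl (incr_step B) (true, acc) l = ((incr B l).1, catrev (incr B l).2 acc).
Proof.
have F k acc' : foldl (incr_step B) (false, acc') k = (false, catrev k acc').
  by elim: k acc' => //= d k IH acc'; rewrite IH.
elim: l acc => //= d l IH acc; rewrite /incr_step /=.
by case: ifP => _; rewrite ?F ?IH.
Qed.

Lemma PT_incr : PT (fun p : nat * seq nat => incr p.1 p.2).
Proof.
have P1 : PT (fun p : nat * seq nat => foldl (incr_step p.1) (true, [::]) p.2).
  apply: (@PT_foldl _ _ _ _ _ _ _ _ (fun p => incr_step p.1) (fun q => esz q.2 + 10)).
  - by pt.
  - by pt.
  - by rewrite /incr_step; pt.
  - by apply: PB_add; [apply: PT_size; pt | apply: PB_const].
  - move=> e [c l] d; rewrite /incr_step /=.
    have := esz_bool true; have := esz_bool false; have := esz_gt0 c.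
    by do ?case: ifP => _; rewrite !esz_pair !esz_cons ?esz_nat; lia.
apply: (@PT_ext _ _ _ _ _ (fun p : nat * seq nat => ((foldl (incr_step p.1) (true, [::]) p.2).1,
   rev (foldl (incr_step p.1) (true, [::]) p.2).2))).
  by apply: PT_pair; [apply: PT_fst | apply: PT_rev; apply: PT_snd].
by move=> [B l]; rewrite incr_foldl /= -[catrev _ _]/(rev _) revK; case: (incr B l).
Qed.

Definition mkenv (w : seq bool) : env :=
  (w, find_n w, affected (find_n w) (beats w (find_n w)),
   elems (find_n w) (affected (find_n w) (beats w (find_n w))), find_k (find_n w),
   find_k (find_n w) + size (elems (find_n w) (affected (find_n w) (beats w (find_n w)))) + 1).

Lemma PT_mkenv : PT mkenv.
Proof.
have Pn := PT_find_n.
have Pa : PT (fun w => affected (find_n w) (beats w (find_n w))).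
  apply: (@PT_comp _ _ _ _ _ _ (fun e : seq bool * nat => affected e.2 (beats e.1 e.2))
    (fun w => (w, find_n w)) PT_affected).
  by apply: PT_pair => //; pt.
have Pal : PT (fun w => elems (find_n w) (affected (find_n w) (beats w (find_n w)))).
  rewrite /elems; apply: PT_filter; first exact: PT_iota0.
  by apply: PT_nth; [pt | apply: (PT_comp Pa); pt | pt].
have Pk : PT (fun w => find_k (find_n w)) by apply: (PT_comp PT_find_k).
rewrite /mkenv; do !apply: PT_pair => //; first by pt.
by apply: PT_addn; [apply: PT_addn => //; apply: PT_size_seq | pt].
Qed.

(* Whether the search goes on, the answer, the instance and the current guess. *)
Notation state := (bool * (bool * (env * seq nat)))%type.

Definition search_step (st : state) : state :=
  if env_check st.2.2.1 st.2.2.2 then (false, (true, st.2.2))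
  else if (incr (e_B st.2.2.1) st.2.2.2).1 then (false, (false, st.2.2))
  else (true, (false, (st.2.2.1, (incr (e_B st.2.2.1) st.2.2.2).2))).

Definition search_init (w : seq bool) : state :=
  (true, (false, (mkenv w, nseq (size (e_al (mkenv w)) + size (e_al (mkenv w))) 0))).

Lemma PT_search_step : PT search_step.
Proof.
have Pi : PT (fun st : state => incr (e_B st.2.2.1) st.2.2.2).
  apply: (@PT_comp _ _ _ _ _ _ (fun p : nat * seq nat => incr p.1 p.2)
    (fun st : state => (e_B st.2.2.1, st.2.2.2)) PT_incr).
  by unenv; pt.
have Pc : PT (fun st : state => env_check st.2.2.1 st.2.2.2).
  by apply: (@PT_comp _ _ _ _ _ _ (fun p => env_check p.1 p.2)
    (fun st : state => st.2.2) PT_check); pt.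
rewrite /search_step; apply: PT_if => //; first by pt.
apply: PT_if; [exact: PT_fst | by pt |].
by pt; exact: Pi.
Qed.

Lemma PT_search_init : PT search_init.
Proof.
have Pe := PT_mkenv.
have Pm : PT (fun w => size (e_al (mkenv w)) + size (e_al (mkenv w))).
  by unenv; apply: PT_addn; apply: PT_size_seq; apply: PT_snd; do 2 apply: PT_fst.
rewrite /search_init; apply: PT_pair; first by pt.
apply: PT_pair; first by pt.
apply: PT_pair; first exact: Pe.
apply: (@PT_ext _ _ _ _ _ (fun w => [seq 0 | _ <- iota 0 (size (e_al (mkenv w)) + size (e_al (mkenv w)))])).
  by apply: PT_map; [apply: PT_iota0 | pt].
by move=> w; rewrite -[in LHS](size_iota 0 (_ + _)); elim: (iota _ _) => //= x l ->.
Qed.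

(** * The search machine *)

(** The last input bit is on top, which is the order in which consing builds a list. Each bit
    becomes its own tree, 100 or 0, below the mark 1 of a cons. *)
Definition mload_loop := mloop (mbind (mpop iT) (fun o =>
  match o with
  | Some true => mseq (mpush iM false) (mseq (mpush iM false) (mseq (mpush iM true) (mpush iM true)))
  | Some false => mseq (mpush iM false) (mpush iM true)
  | None => mret None
  end)).
Definition mload := mseq (mpush iM false) mload_loop.

Lemma runs_load_loop (l acc : seq bool) :
  runs mload_loop (l, ser (enc acc), [::], [::]) None (onmain (ser (enc (catrev l acc))))
    (5 * size l + 1).
Proof.
elim: l acc => [|b l IH] acc.
  apply: runs_loop_exit => //; rewrite -[X in runs _ _ _ _ X]/(1 + 0).
  by apply: runs_bind (runs_pop _ _) _; apply: runs_ret.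
have -> : 5 * size (b :: l) + 1 = 5 + (5 * size l + 1) by rewrite /=; lia.
apply: runs_loop_next (IH (b :: acc)).
case: b.
  rewrite -[5]/(1 + (1 + (1 + (1 + 1)))); apply: runs_bind (runs_pop _ _) _ => /=.
  do 3 (apply: runs_seq; first exact: runs_push).
  exact: runs_push.
apply: (@runs_weaken _ _ _ _ (1 + (1 + 1))) => //; apply: runs_bind (runs_pop _ _) _ => /=.
by apply: runs_seq; apply: runs_push.
Qed.

Lemma runs_load w :
  runs mload (rev w, [::], [::], [::]) None (onmain (ser (enc w))) (5 * size w + 2).
Proof.
have -> : 5 * size w + 2 = 1 + (5 * size w + 1) by lia.
apply: runs_seq (runs_push _ _ _) _; rewrite -(size_rev w).
by have := runs_load_loop (rev w) [::]; rewrite -[catrev _ _]/(rev _) revK.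
Qed.

(** The serialised final state starts with 1, 0, 1 for the two pairs and the cleared flag between
    them, so the fourth bit is the answer. *)
Definition mread := mseq (mpop iM) (mseq (mpop iM) (mseq (mpop iM) (mpop iM))).

Lemma runs_read (b : bool) (t : tree) : exists s,
  runs mread (onmain (ser (Node Leaf (Node (enc b) t)) ++ [::])) (Some b) s 4.
Proof.
rewrite -[4]/(1 + (1 + (1 + 1))).
case: b; eexists; do 3 (apply: runs_seq; [exact: runs_pop | rewrite /=]);
  exact: (@runs_pop iM ([::], _ :: _, [::], [::])).
Qed.

Section Search.
Variable w : seq bool.
Let e := mkenv w.
Let m := size (e_al e) + size (e_al e).
Let Q := e_B e ^ m.

Lemma e_B_gt0 : 0 < e_B e. Proof. by rewrite /e_B /e /= addn1. Qed.

Lemma iter_search i : i < Q -> (forall j, j < i -> ~~ env_check e (guess (e_B e) m j)) ->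
  iter i search_step (search_init w) = (true, (false, (e, guess (e_B e) m i))).
Proof.
elim: i => [|i IH] lti nc //.
rewrite iterS IH; [|exact: ltnW|by move=> j ltj; apply: nc; apply: ltnW].
rewrite /search_step /= (negbTE (nc i _)) // guess_overflow ?e_B_gt0 //; last exact: ltnW.
by rewrite (ltn_eqF lti).
Qed.

(** Each turn tests one guess. The search stops right after the least accepted index, or after [Q]
    turns when the odometer overflows. *)
Lemma search_result : exists (N : nat) (ans : bool) g,
  [/\ N <= Q, iter N search_step (search_init w) = (false, (ans, (e, g))),
      forall i, i < N -> iter i search_step (search_init w) = (true, (false, (e, guess (e_B e) m i))) &
      ans <-> exists2 i, i < Q & env_check e (guess (e_B e) m i)].
Proof.
have Q0 : 0 < Q by rewrite expn_gt0 e_B_gt0.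
case: (boolP (has (fun i => env_check e (guess (e_B e) m i)) (iota 0 Q))) => [/hasP[i0 i0Q ci0]|/hasPn nc].
  have ex : exists i, (i < Q) && env_check e (guess (e_B e) m i).
    by exists i0; rewrite ci0 andbT; move: i0Q; rewrite mem_iota.
  case: (ex_minnP ex) => i /andP[lti ci] mini.
  have nc j : j < i -> ~~ env_check e (guess (e_B e) m j).
    move=> ltj; apply/negP => cj; have := mini j; rewrite cj (ltn_trans ltj lti) => /(_ isT).
    by rewrite leqNgt ltj.
  exists i.+1, true, (guess (e_B e) m i); split=> //.
  - by rewrite iterS iter_search // /search_step /= ci.
  - move=> j; rewrite ltnS => lej; apply: iter_search; first exact: leq_ltn_trans lej lti.
    by move=> j' ltj'; apply: nc; apply: leq_trans ltj' lej.
  - by split=> // _; exists i.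
have nc' i : i < Q -> ~~ env_check e (guess (e_B e) m i) by move=> lti; apply: nc; rewrite mem_iota.
exists Q, false, (guess (e_B e) m Q.-1); split=> //.
- rewrite -(prednK Q0) iterS iter_search ?prednK //; last by move=> j ltj; apply: nc'; lia.
  rewrite /search_step /= (negbTE (nc' _ _)) ?prednK // guess_overflow ?e_B_gt0 ?prednK //.
  by rewrite eqxx.
- by move=> i lti; apply: iter_search => // j ltj; apply: nc'; apply: ltn_trans ltj lti.
- by split=> // -[i lti]; rewrite (negbTE (nc' _ lti)).
Qed.

(** The odometer preserves the length and the digit range of the guess, so states remain polynomial
    in the instance however long the search takes. *)
Lemma esz_search i : esz (true, (false, (e, guess (e_B e) m i))) <=
  esz e + 2 * esz e * (2 * esz e + 2) + 12.
Proof.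
rewrite 3!esz_pair; have := esz_bool true; have := esz_bool false.
have le : esz (guess (e_B e) m i) <= m * ((e_B e).*2 + 2) + 1.
  have := @esz_seq_nat (guess (e_B e) m i) (e_B e); rewrite guess_size; apply.
  apply: sub_all (guess_all e_B_gt0 m i) => d /=; exact: ltnW.
have h1 : size (e_al e) <= esz e.
  apply: leq_trans (size_esz _) _; move: (e) => [[[[[w' n'] a'] al'] k'] B'].
  by rewrite !esz_pair /e_al /=; lia.
have h2 : e_B e <= esz e.
  move: (e) => [[[[[w' n'] a'] al'] k'] B']; rewrite !esz_pair /e_B /= (esz_nat B') -addnn; lia.
have hm : m <= 2 * esz e by rewrite /m; lia.
have hB : (e_B e).*2 + 2 <= 2 * esz e + 2 by rewrite -addnn; lia.
have := leq_mul hm hB; move: le.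
move: (esz (guess _ _ _)) (m * _) (2 * esz e * _) (esz true) (esz false) => x1 x2 x3 x4 x5.
by lia.
Qed.
End Search.

Definition guesses (w : seq bool) :=
  e_B (mkenv w) ^ (size (e_al (mkenv w)) + size (e_al (mkenv w))).

Theorem search_machine : exists (M : machine) (c : nat), forall w, exists ans s' t,
  [/\ runs M (rev w, [::], [::], [::]) (Some ans) s' t,
      t <= guesses w * (c * esz w ^ c) &
      ans <-> exists2 i, i < guesses w & env_check (mkenv w)
        (guess (e_B (mkenv w)) (size (e_al (mkenv w)) + size (e_al (mkenv w))) i)].
Proof.
have [Mi [Ti [MiP TiP]]] := PT_search_init.
have [Ms [Ts [MsP [cs TsP]]]] := PT_search_step.
have se := PT_size PT_mkenv.
pose (K := fun w : seq bool =>
  cs * (esz (mkenv w) + 2 * esz (mkenv w) * (2 * esz (mkenv w) + 2) + 12) ^ cs).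
have : PB (fun w : seq bool => (5 * esz w + 2) + (Ti w + ((K w + 4 + 4) + 4))).
  by rewrite /K; pb.
case=> c cP; exists (mseq mload (mseq Mi (mseq (mwhile Ms) mread))), c => w.
have [N [ans [g [leN eN itN ansP]]]] := search_result w.
have wh : trans (mwhile Ms) [:: enc (search_init w)] [:: enc (iter N search_step (search_init w))]
    (N * (K w + 4) + 4).
  apply: (@trans_while Ms (fun i => enc (iter i search_step (search_init w)))).
  - by move=> i /itN ->; do 3 eexists.
  - by rewrite eN; eexists.
  - move=> i /itN lti; rewrite iterS; apply: trans_weaken (MsP _) _.
    apply: leq_trans (TsP _) _; rewrite /K leq_mul2l; apply/orP; right.
    by case: (cs) => // c'; rewrite leq_exp2r // lti; apply: esz_search.
have [x1 r1] := MiP w [::]; have [x2 r2] := wh [::].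
rewrite eN in r2.
have [s r3] := runs_read ans (enc (mkenv w, g)).
exists ans, s, ((5 * size w + 2) + (Ti w + ((N * (K w + 4) + 4) + 4))); split=> //.
  apply: runs_seq (runs_load w) _.
  have -> : ser (enc w) = flat [:: enc w] ++ [::] by rewrite flat_cons !cats0.
  apply: runs_seq r1 _; apply: runs_seq r2 _.
  by rewrite flat_cons -catA; exact: r3.
have Q0 : 0 < guesses w by rewrite expn_gt0 e_B_gt0.
apply: leq_trans (leq_mul (leqnn (guesses w)) (cP w)).
have sw : size w <= esz w by exact: size_esz.
move: leN; rewrite -/(guesses w) => leN.
have h : N * (K w + 4) <= guesses w * (K w + 4) by rewrite leq_mul2r leN orbT.
have -> : 5 * esz w + 2 + (Ti w + (K w + 4 + 4 + 4)) = (K w + 4) + (5 * esz w + Ti w + 10) by lia.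
rewrite [X in _ <= X]mulnDr.
have hX : 5 * esz w + Ti w + 10 <= guesses w * (5 * esz w + Ti w + 10) by exact: leq_pmull.
move: h hX sw; move: (N * _) (guesses w * (K w + 4)) => y1 y2.
by move: (guesses w * _) => y3; lia.
Qed.

(* With q = x / m: x <= m (q + 1) <= m 2^q, hence x^m <= m^m 2^(q m). *)
Lemma expn_le_self_exp2 x m : x ^ m <= m ^ m * 2 ^ x.
Proof.
case: (posnP m) => [->|m0]; first by rewrite !expn0 mul1n expn_gt0.
pose q := x %/ m; apply: (@leq_trans ((m * 2 ^ q) ^ m)).
  rewrite leq_exp2r //; apply: leq_trans (ltnW (ltn_ceil x m0)) _.
  by rewrite mulnC leq_mul2l; apply/orP; right; apply: ltn_expl.
by rewrite expnMn -expnM leq_mul2l leq_exp2l // leq_trunc_div orbT.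
Qed.

Lemma self_exp_mono a b : a <= b -> a ^ a <= b ^ b.
Proof.
case: a => [|a] le; first by case: b le => // b _; rewrite expn_gt0.
by apply: (@leq_trans (b ^ a.+1)); [rewrite leq_exp2r | apply: leq_pexp2l => //; apply: leq_trans le].
Qed.

(** With L the rounded logarithm, [6 * s <= 2 ^ (3 + L)] bounds the exponent of 2 by 6s(3 + L) + k +
    3s + 1, that is, 21s + 6sL + k + 1. The inequality used for 21s needs the additive 21 because L
    = 0 for s = 1; together this gives the factor [2 ^ 22]. *)
Lemma guesses_bound : exists X, forall s k m, m <= 3 * s ->
  (k + m + 1) ^ (m + m) <= X * 2 ^ (28 * (s * up_log 2 s)) * 2 ^ k.
Proof.
exists (2 ^ 22) => s k m le; set L := up_log 2 s.
have h6 : 6 * s <= 2 ^ (3 + L).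
  by rewrite expnD; apply: leq_mul => //; apply: up_logP.
apply: leq_trans (expn_le_self_exp2 _ _) _.
apply: (@leq_trans ((2 ^ (3 + L)) ^ (6 * s) * 2 ^ (k + m + 1))).
  rewrite leq_mul2r; apply/orP; right; apply: leq_trans (@self_exp_mono _ (6 * s) _) _; first by lia.
  by case: (posnP (6 * s)) => [->//|s0]; rewrite leq_exp2r.
rewrite -expnM -!expnD leq_exp2l //.
have : 21 * s <= 21 + 21 * (s * L).
  case: (s) @L {le h6} => [|[|s']] L //; have : 0 < L by rewrite up_log_gt0.
  by nia.
by nia.
Qed.

Lemma nth_flatten_const (T : Type) (x0 : T) (rows : seq (seq T)) c i j :
  (forall r, List.In r rows -> size r = c) -> j < c ->
  nth x0 (flatten rows) (i * c + j) = nth x0 (nth [::] rows i) j.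
Proof.
move=> rc ltj; elim: rows i rc => [|r rows IH] i rc; first by rewrite !nth_nil.
have sr : size r = c by apply: rc; left.
rewrite /= nth_cat sr; case: i => [|i]; first by rewrite ltj.
rewrite ifF; last by rewrite mulSn; lia.
have -> : i.+1 * c + j - c = i * c + j by rewrite mulSn; lia.
by apply: IH => r' h; apply: rc; right.
Qed.

(** * Encoded instances as tournaments on natural numbers *)

Section Instance.
Variables (k : nat) (D : rel 'I_(2 ^ k)) (v : 'I_(2 ^ k)).
Let n := 2 ^ k.
Let w := encode_instance D v.

Lemma size_instance : size w = n + n * n.
Proof. by rewrite /w size_cat size_map size_allpairs !size_enum_ord. Qed.

Lemma instance_player (x : nat) : x < n -> nth false w x = (x == v).
Proof.
move=> lt; rewrite /w nth_cat size_map size_enum_ord lt (nth_map v) ?size_enum_ord //.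
by rewrite -val_eqE /= nth_enum_ord.
Qed.

Lemma instance_beats (i j : 'I_(2 ^ k)) : beats w n i j = D i j.
Proof.
rewrite /beats -addnA /w nth_cat size_map size_enum_ord ltnNge leq_addr /= addKn.
rewrite nth_flatten_const; last exact: ltn_ord.
  rewrite (nth_map i) ?size_enum_ord // (nth_map j) ?size_enum_ord //.
  by rewrite !nth_ord_enum.
by move=> r /List.in_map_iff[x [<- _]]; rewrite size_map size_enum_ord.
Qed.

Lemma beats_big (x y : nat) : n <= x -> beats w n x y = false.
Proof. by move=> le; rewrite /beats nth_default // size_instance; nia. Qed.

Lemma ko_round_val (s : seq 'I_(2 ^ k)) :
  map val (ko_round D s) = ko_round (beats w n) (map val s).
Proof.
move: {2}(size s) (leqnn (size s)) => m; elim: m s => [|m IH] [|x [|y s]] //= le.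
rewrite instance_beats IH; last by rewrite ltnW.
by case: (D x y).
Qed.

Lemma iter_ko_val j (s : seq 'I_(2 ^ k)) :
  map val (iter j (ko_round D) s) = iter j (ko_round (beats w n)) (map val s).
Proof. by elim: j => //= j IH; rewrite ko_round_val IH. Qed.

Lemma TFP_nat : TFP_yes D v <->
  exists2 s, perm_eq s (iota 0 n) & iter k (ko_round (beats w n)) s = [:: val v].
Proof.
split=> [[s [ps its]]|[s ps its]].
  exists (map val s); last by rewrite -iter_ko_val its.
  by rewrite -val_enum_ord; apply: perm_map.
have es : map val [seq insubd v x | x <- s] = s.
  rewrite -map_comp map_id_in // => x; rewrite (perm_mem ps) mem_iota /= add0n => lt.
  by rewrite insubdK.
exists [seq insubd v x | x <- s]; split.
  by apply: (perm_map_inj val_inj); rewrite es val_enum_ord.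
by apply: (inj_map val_inj); rewrite iter_ko_val es its.
Qed.

Hypothesis Dt : is_tournament D.

Lemma beats_tot x y : x < n -> y < n -> x != y -> beats w n x y = ~~ beats w n y x.
Proof.
move=> ltx lty nxy; rewrite -[x]/(val (Ordinal ltx)) -[y]/(val (Ordinal lty)) !instance_beats.
by apply: Dt.2; rewrite -val_eqE.
Qed.

Lemma beats_irr x : ~~ beats w n x x.
Proof.
case: (ltnP x n) => [ltx|/beats_big-> //].
by rewrite -[x]/(val (Ordinal ltx)) instance_beats; apply: Dt.1.
Qed.

Variables (s_in s_out : nat).
Hypothesis hin : sfas_in_number D v s_in.
Hypothesis hout : sfas_out_number D v s_out.

(** A triangle without an arc in [F] survives the reversal and is a cycle through [u]. *)
Lemma triangle_hit (X : pred 'I_(2 ^ k)) F x y z u :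
  kills_cycles_through D X F -> D x y -> D y z -> D z x -> u \in [:: x; y; z] -> X u ->
  [\/ (x, y) \in F, (y, z) \in F | (z, x) \in F].
Proof.
move=> [_ kill] Dxy Dyz Dzx uc Xu.
case: (boolP ((x, y) \in F)) => [|n1]; first by constructor 1.
case: (boolP ((y, z) \in F)) => [|n2]; first by constructor 2.
case: (boolP ((z, x) \in F)) => [|n3]; first by constructor 3.
have ne a b : D a b -> a != b by move=> h; apply/eqP => e; move: h; rewrite e (negbTE (Dt.1 _)).
have dc : dcycle (reverse_arcs D F) [:: x; y; z].
  split=> //; split.
    by rewrite /= !inE negb_or (ne _ _ Dxy) (ne _ _ Dyz) eq_sym (ne _ _ Dzx).
  by rewrite /= /reverse_arcs Dxy Dyz Dzx n1 n2 n3.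
by have := kill _ dc u uc; rewrite Xu.
Qed.

Lemma size_affected_le : size (elems n (affected n (beats w n))) <= 3 * (s_in + s_out).
Proof.
have [[F1 [c1 k1]] _] := hin; have [[F2 [c2 k2]] _] := hout.
pose F := [seq (val e.1, val e.2) | e <- enum (F1 :|: F2)].
apply: (@leq_trans (3 * size F)).
  apply: size_affected => [e /mapP[e' _ ->]|x y z ltx lty ltz]; first by rewrite !ltn_ord.
  rewrite -[x]/(val (Ordinal ltx)) -[y]/(val (Ordinal lty)) -[z]/(val (Ordinal ltz)).
  move: (Ordinal ltx) (Ordinal lty) (Ordinal ltz) => {x y z ltx lty ltz}x y z.
  rewrite !instance_beats => Dxy Dyz Dzx.
  have memF a b : (a, b) \in F1 :|: F2 -> (val a, val b) \in F.
    by move=> h; apply/mapP; exists (a, b); rewrite ?mem_enum.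
  (* Every player other than [v] is an in- or out-neighbour of [v], which decides whether [F1] or
     [F2] hits the triangle. *)
  have [u uc nuv] : exists2 u, u \in [:: x; y; z] & u != v.
    case: (eqVneq x v) => [e|ne]; last by exists x; rewrite ?mem_head.
    exists y; rewrite ?inE ?eqxx ?orbT //; apply/eqP => e'.
    by move: Dxy; rewrite e e' (negbTE (Dt.1 _)).
  have [h|h|h] : [\/ (x, y) \in F1 :|: F2, (y, z) \in F1 :|: F2 | (z, x) \in F1 :|: F2].
    case Duv: (D u v).
      have [h|h|h] := triangle_hit k1 Dxy Dyz Dzx uc Duv;
      [constructor 1|constructor 2|constructor 3]; by rewrite inE h.
    have Dvu : D v u by rewrite Dt.2 ?Duv // eq_sym.
    have [h|h|h] := triangle_hit k2 Dxy Dyz Dzx uc Dvu;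
    [constructor 1|constructor 2|constructor 3]; by rewrite inE h orbT.
  - by constructor 1; apply: memF.
  - by constructor 2; apply: memF.
  - by constructor 3; apply: memF.
rewrite leq_mul2l /= size_map -cardE -c1 -c2; exact: leq_card_setU.
Qed.

Lemma mkenvE : mkenv w = (w, n, affected n (beats w n), elems n (affected n (beats w n)), k,
  k + size (elems n (affected n (beats w n))) + 1).
Proof. by rewrite /mkenv (find_nE size_instance) find_kE. Qed.

Lemma search_correct :
  (exists2 i, i < guesses w & env_check (mkenv w)
     (guess (e_B (mkenv w)) (size (e_al (mkenv w)) + size (e_al (mkenv w))) i)) <->
  TFP_yes D v.
Proof.
rewrite TFP_nat /guesses mkenvE /env_check /e_D /e_w /e_n /e_a /e_al /e_k /e_B /=.
set a := affected _ _; set m := size _.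
have ltv : val v < n by exact: ltn_ord.
split=> [[i _]|[s ps its]].
  apply: check_sound => //; rewrite /elems.
  have -> : [seq x <- iota 0 n | nth false w x] = [seq x <- iota 0 n | x == val v].
    by apply: eq_in_filter => x; rewrite mem_iota /= add0n => /instance_player.
  by rewrite filter_pred1_uniq ?iota_uniq // mem_iota.
have ms x : (x \in s) = (x < n) by rewrite (perm_mem ps) mem_iota.
have [|||tau [pi [root par inj ex]]] := @seeding_brackets _ 0 (beats w n) k s (val v) _ _ _ its.
- by move=> x y; rewrite !ms; apply: beats_tot.
- by rewrite (perm_uniq ps) iota_uniq.
- by rewrite (perm_size ps) size_iota.
have so : sol n k (val v) (beats w n) tau pi.
  split=> //.
  - by move=> y lty nyv; have := par y; rewrite !ms; apply.
  - by move=> y z lty ltz; apply: inj; rewrite ms.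
  - move=> x t ltx tx tk; have [|y [ys nyv ey ty]] := ex x t _ tx tk; first by rewrite ms.
    by exists y; rewrite -ms.
have [g [sg ag cg]] := @check_complete n k (val v) (beats w n) beats_tot beats_irr ltv a
  (@affected_noTri n (beats w n)) w tau pi so instance_player.
have B0 : 0 < k + m + 1 by rewrite addn1.
by have [i lti eg] := guess_surj B0 sg ag; exists i; rewrite // eg.
Qed.

Lemma guesses_le X : (forall s k m, m <= 3 * s ->
    (k + m + 1) ^ (m + m) <= X * 2 ^ (28 * (s * up_log 2 s)) * 2 ^ k) ->
  guesses w <= X * 2 ^ (28 * ((s_in + s_out) * up_log 2 (s_in + s_out))) * n.
Proof. by move=> XP; rewrite /guesses mkenvE /e_B /e_al /=; apply: XP; apply: size_affected_le. Qed.

Lemma esz_instance : esz w <= 9 * n ^ 2.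
Proof.
apply: leq_trans (esz_mask _) _; rewrite size_instance.
have n0 : 0 < n by rewrite expn_gt0.
by rewrite -mulnn; move: (n) n0 => n' n0; nia.
Qed.
End Instance.

Theorem theorem3 :
  exists (M : TM) (c : nat),
    forall (k : nat) (D : rel 'I_(2 ^ k)) (v : 'I_(2 ^ k)),
      is_tournament D ->
      forall s_in s_out : nat,
        sfas_in_number D v s_in ->
        sfas_out_number D v s_out ->
        let s := s_in + s_out in
        exists (t : nat) (b : bool),
          t <= c * 2 ^ (c * (s * up_log 2 s)) * (2 ^ k) ^ c /\
          @tm_run M t (tm_init M (encode_instance D v)) = Some b /\
          (b <-> TFP_yes D v).
Proof.
have [M [c MP]] := search_machine; have [X XP] := guesses_bound.
pose Y := X * (c.+1 * 9 ^ c.+1).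
(* One constant dominates three: the factor, and the exponents [56 = 2 * 28] and
   [4 * c + 6 = 2 * (2 * c + 3)], doubled by the quadratic cost of the simulation. *)
exists (TM_of M), (12 * (Y * Y) + 56 + (4 * c + 6)) => k D v Dt s_in s_out hin hout s.
set w := encode_instance D v; set n := 2 ^ k; set P := s * up_log 2 s.
have [ans [s' [t [run let_ ansP]]]] := MP w.
have [t' let' run'] := TM_of_correct run.
exists t', ans; split; last first.
  split; first by rewrite run'; case: (ans).
  by rewrite -(search_correct v Dt).
have n0 : 0 < n by rewrite expn_gt0.
have z0 : 0 < esz w by exact: esz_gt0.
have Gle := guesses_le Dt hin hout XP; rewrite -/w -/n -/s -/P in Gle.
(* Taking [c.+1] for [c] makes [R] at least [esz w], so that it bounds the input length as well as
   the time. *)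
pose (R := guesses w * (c.+1 * esz w ^ c.+1)).
have G0 : 0 < guesses w by rewrite expn_gt0 e_B_gt0.
have tR : t <= R.
  apply: leq_trans let_ _; rewrite leq_mul2l; apply/orP; right.
  by apply: leq_mul => //; apply: leq_pexp2l.
have zR : esz w <= R.
  rewrite /R mulnA; apply: (@leq_trans (esz w ^ c.+1)); first by rewrite expnS leq_pmulr // expn_gt0 z0.
  by rewrite leq_pmull // muln_gt0 G0.
have wR : size w <= R by apply: leq_trans zR; exact: size_esz.
have R0 : 0 < R by apply: leq_trans zR.
(* The exponent of [n] is [2 * c.+1] from the quadratic size of the instance, plus one from the
   number of guesses. *)
have RY : R <= Y * 2 ^ (28 * P) * n ^ (2 * c + 3).
  have z1 : esz w ^ c.+1 <= 9 ^ c.+1 * n ^ (2 * c + 2).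
    have -> : 2 * c + 2 = 2 * c.+1 by lia.
    by rewrite expnM -expnMn leq_exp2r //; apply: esz_instance.
  apply: leq_trans (leq_mul Gle (leq_mul (leqnn c.+1) z1)) _.
  have -> : n ^ (2 * c + 3) = n * n ^ (2 * c + 2) by rewrite -expnS; congr (_ ^ _); lia.
  by apply: eq_leq; rewrite /Y; move: (2 ^ _) (n ^ _) (9 ^ _) => q1 q2 q3; lia.
(* With time and input length at most [R], the simulation bound is at most [R * (4 * R + 5) + 3]; 12
   is 4 + 5 + 3. *)
apply: leq_trans let' _; apply: (@leq_trans (12 * (R * R))).
  rewrite -addnn; apply: (@leq_trans (R * ((R + R) + (R + R) + 5) + 3)); last by nia.
  by rewrite leq_add2r; apply: leq_mul => //; lia.
apply: leq_trans (leq_mul (leqnn 12) (leq_mul RY RY)) _.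
set C := 12 * (Y * Y) + 56 + (4 * c + 6).
apply: (@leq_trans (12 * (Y * Y) * 2 ^ (56 * P) * n ^ (4 * c + 6))).
  have -> : 2 ^ (56 * P) = 2 ^ (28 * P) * 2 ^ (28 * P) by rewrite -expnD; congr (_ ^ _); lia.
  have -> : n ^ (4 * c + 6) = n ^ (2 * c + 3) * n ^ (2 * c + 3) by rewrite -expnD; congr (_ ^ _); lia.
  by apply: eq_leq; move: (2 ^ _) (n ^ _) => q1 q2; lia.
apply: leq_mul; [apply: leq_mul|].
- by rewrite /C -addnA leq_addr.
- by apply: leq_pexp2l => //; rewrite leq_mul2r; apply/orP; right; rewrite /C addnAC leq_addl.
- by apply: leq_pexp2l => //; rewrite /C leq_addl.
Qed.
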